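(* Let $\Sigma_1$ and $\Sigma_2$ be connected surfaces with compact boundaries $\partial\Sigma_1,\partial\Sigma_2$ (possibly empty). Let $A_1\subset\Sigma_1$, $A_2\subset \Sigma_2$ be countable dense subsets such that $A_1\cap\partial\Sigma_1=\emptyset=A_2\cap\partial\Sigma_2$, and put $\mathring\Sigma_i:=\Sigma_i\setminus A_i$ for $i=1,2$. Then any homeomorphism $f:\mathring\Sigma_1\to\mathring\Sigma_2$ extends to a homeomorphism $\mathcal E(f):\mathcal E(\Sigma_1)\to\mathcal E(\Sigma_2)$ of the Freudenthal compactifications. If neither $\Sigma_1$ nor $\Sigma_2$ has a planar end, then $f$ extends to a homeomorphism $\tilde f:\Sigma_1\to\Sigma_2$.
   Context: A surface is a paracompact (equivalently, for connected ones, second countable metrizable) 2-manifold, here possibly with boundary. For a non-compact connected surface $\Sigma$, an end is represented by a decreasing sequence $M_1\supset M_2\supset\cdots$ where each $M_n$ is a connected component of $\Sigma\setminus S_n$ for some compact subsurface $S_n$ (with boundary), and such that every compact $C\subset\Sigma$ satisfies $C\cap M_k=\emptyset$ for all large $k$; two such sequences represent the same end if every member of each sequence contains some member of the other. $E(\Sigma)$ denotes the (Freudenthal) space of ends, and $\mathcal E(\Sigma)=\Sigma\cup E(\Sigma)$ the Freudenthal (end) compactification: open sets of $\Sigma$ are open in $\mathcal E(\Sigma)$, and a neighbourhood basis of an end $\epsilon$ is given by the sets consisting of the component $P$ of $\Sigma\setminus S$ which contains $M_n$ for large $n$ (where $(M_n)$ represents $\epsilon$) together with all ends whose representing sequences are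 eventually contained in $P$, as $S$ ranges over compact subsurfaces. If $\Sigma$ is compact, $E(\Sigma)=\emptyset$ and $\mathcal E(\Sigma)=\Sigma$. An end represented by $(M_n)$ is planar if $M_k$ embeds in $\mathbb R^2$ for some $k$. *)

(* Defs.v *)
From HB Require Import structures.
From mathcomp Require Import all_boot all_order all_algebra generic_quotient.
From mathcomp Require Import all_classical all_reals all_analysis.

Set Implicit Arguments.
Unset Strict Implicit.
Unset Printing Implicit Defensive.

Import Order.TTheory GRing.Theory Num.Theory.
Import numFieldNormedType.Exports.

Local Open Scope classical_set_scope.
Local Open Scope ring_scope.
Local Open Scope quotient_scope.

Definition homeomorphism (X Y : topologicalType) (f : X -> Y) : Prop :=
  continuous f /\
  exists g : Y -> X, [/\ continuous g, cancel f g & cancel g f].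

Definition homeomorphic (X Y : topologicalType) : Prop :=
  exists f : X -> Y, homeomorphism f.

Definition embeds (X Y : topologicalType) : Prop :=
  exists B : set Y, homeomorphic X B.

Definition paracompact (T : topologicalType) : Prop :=
  forall C : set (set T), C `<=` open -> \bigcup_(A in C) A = [set: T] ->
  exists D : set (set T),
    [/\ D `<=` open, \bigcup_(B in D) B = [set: T],
        forall B, D B -> exists2 A, C A & B `<=` A &
        forall x : T, exists2 N, nbhs x N &
          finite_set [set B | D B /\ B `&` N !=set0]].

Definition half_plane (R : realType) : set (R * R) := [set p | 0 <= p.2].
Arguments half_plane R : clear implicits.

Definition surface (R : realType) (T : topologicalType) : Prop :=
  [/\ hausdorff_space T, paracompact T &
      forall x : T, exists2 U : set T, open_nbhs x U &
        exists2 W : set (R * R), open W & homeomorphic U (W `&` half_plane R)].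

Definition surface_interior (R : realType) (T : topologicalType) : set T :=
  [set x | exists2 U : set T, open_nbhs x U &
     exists2 W : set (R * R), open W & homeomorphic U W].
Arguments surface_interior R T : clear implicits.

Definition surface_boundary (R : realType) (T : topologicalType) : set T :=
  ~` surface_interior R T.
Arguments surface_boundary R T : clear implicits.

(* The subset is a surface for the induced topology; it may be empty or
   disconnected, and it may meet the boundary of T. *)
Definition compact_subsurface (R : realType) (T : topologicalType)
    (S : set T) : Prop :=
  compact S /\ surface R S.

Definition is_component (T : topologicalType) (A M : set T) : Prop :=
  exists2 x, A x & M = connected_component A x.

Definition end_sequence (R : realType) (T : topologicalType) :
    set (nat -> set T) :=
  [set M | [/\ forall n, M n.+1 `<=` M n,
               forall n, exists2 S : set T, compact_subsurface R S &
                           is_component (~` S) (M n) &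
               forall C : set T, compact C ->
                 \forall k \near \oo, C `&` M k = set0]].
Arguments end_sequence R T : clear implicits.

Section ends.
Context (R : realType) (T : topologicalType).

Definition end_rep : Type := end_sequence R T.
HB.instance Definition _ := Choice.on end_rep.

Implicit Types (M N : end_rep) (P : set T).

Definition same_end M N : bool :=
  `[< (forall m, exists n, val N n `<=` val M m) /\
      (forall n, exists m, val M m `<=` val N n) >].

Lemma same_end_refl : reflexive same_end.
Proof. by move=> M; apply/asboolP; split=> n; exists n. Qed.

Lemma same_end_sym : symmetric same_end.
Proof. by move=> M N; apply/asboolP/asboolP => -[]. Qed.

Lemma same_end_trans : transitive same_end.
Proof.
move=> N M O /asboolP[NM MN] /asboolP[ON NO]; apply/asboolP; split=> k.
- have [n nM] := NM k; have [m mN] := ON n.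
  by exists m; exact: subset_trans nM.
- have [n nO] := NO k; have [m mN] := MN n.
  by exists m; exact: subset_trans nO.
Qed.

Canonical same_end_equiv :=
  EquivRel same_end same_end_refl same_end_sym same_end_trans.

Definition end_space : Type := {eq_quot same_end_equiv}.
HB.instance Definition _ := Choice.on end_space.

Definition represents M (e : end_space) : Prop :=
  \pi_({eq_quot same_end_equiv}) M = e.

(* As representing sequences are decreasing, M n `<=` P for one n amounts to
   M n `<=` P for all large n. *)
Definition end_in (e : end_space) P : Prop :=
  forall M, represents M e -> exists n, val M n `<=` P.

Definition planar_end (e : end_space) : Prop :=
  exists2 M, represents M e & exists k, embeds (val M k) (R * R)%type.

Lemma end_repP (e : end_space) : exists M, represents M e.
Proof. by exists (repr (e : {eq_quot same_end_equiv})); exact: reprK. Qed.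

Lemma same_endP M N (e : end_space) : represents M e -> represents N e ->
  forall m, exists n, val N n `<=` val M m.
Proof. by move=> <- /eqmodP/asboolP[]. Qed.

Lemma end_inP M (e : end_space) P :
  represents M e -> end_in e P <-> exists n, val M n `<=` P.
Proof.
move=> Me; split=> [/(_ _ Me)//|[m mP] N Ne].
by have [n nM] := same_endP Me Ne m; exists n; exact: subset_trans mP.
Qed.

Lemma end_rep_decr M m n : (m <= n)%N -> val M n `<=` val M m.
Proof.
have [decM _ _] := set_valP M; elim: n => [|n IH].
  by rewrite leqn0 => /eqP->.
rewrite leq_eqVlt => /predU1P[->//|/IH]; apply: subset_trans.
exact: decM.
Qed.

Definition end_compactification : Type := (T + end_space)%type.
HB.instance Definition _ := Choice.on end_compactification.

Definition end_hat P : set end_compactification :=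
  [set z | match z with inl x => P x | inr e => end_in e P end].

Definition end_base (e : end_space) P : Prop :=
  (exists2 S : set T, compact_subsurface R S & is_component (~` S) P) /\
  end_in e P.

Definition end_open (U : set end_compactification) : Prop :=
  open (inl @^-1` U : set T) /\
  forall e, U (inr e) -> exists2 P, end_base e P & end_hat P `<=` U.

Lemma end_base_rep M (e : end_space) n : represents M e -> end_base e (val M n).
Proof.
move=> Me; have [_ + _] := set_valP M => /(_ n) compM.
by split=> //; apply/(end_inP _ Me); exists n.
Qed.

Lemma end_hatS P Q : P `<=` Q -> end_hat P `<=` end_hat Q.
Proof.
move=> PQ [x /PQ//|e eP M /eP[n nP]].
by exists n; exact: subset_trans PQ.
Qed.

Lemma end_openT : end_open setT.
Proof.
split=> [|e _]; first exact: openT.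
have [M Me] := end_repP e.
by exists (val M 0%N) => //; exact: end_base_rep.
Qed.

Lemma end_openI : setI_closed end_open.
Proof.
move=> U V [oU eU] [oV eV]; split=> [|e [/eU[P [_ eP] PU] /eV[Q [_ eQ] QV]]].
  exact: openI.
have [M Me] := end_repP e.
have [m mP] := eP _ Me; have [n nQ] := eQ _ Me.
exists (val M (maxn m n)); first exact: end_base_rep.
rewrite subsetI; split.
- apply: subset_trans PU; apply: end_hatS; apply: subset_trans mP.
  by apply: end_rep_decr; exact: leq_maxl.
- apply: subset_trans QV; apply: end_hatS; apply: subset_trans nQ.
  by apply: end_rep_decr; exact: leq_maxr.
Qed.

Lemma end_open_bigU (I : Type) (f : I -> set end_compactification) :
  (forall i, end_open (f i)) -> end_open (\bigcup_i f i).
Proof.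
move=> of_; split=> [|e [i _ /(of_ i).2[P eP PU]]].
  by rewrite preimage_bigcup; apply: bigcup_open => i _; exact: (of_ i).1.
by exists P => //; apply: subset_trans PU _; exact: bigcup_sup.
Qed.

HB.instance Definition _ := isOpenTopological.Build end_compactification
  end_openT end_openI end_open_bigU.

Lemma open_inl (U : set T) :
  open U -> open (inl @` U : set end_compactification).
Proof.
move=> oU; split=> [|e [x _]//]; rewrite (_ : _ @^-1` _ = U)//.
by apply/seteqP; split=> [x [y Uy [<-]]//|x Ux]; exists x.
Qed.

(* In a surface the components of the complement of a compact subsurface are
   open, so that the sets [end_hat P] with [end_base e P] form a neighbourhood
   basis of [e]. *)
Lemma open_end_hat (S P : set T) : compact_subsurface R S ->
  is_component (~` S) P -> open P -> open (end_hat P).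
Proof. by move=> cS SP oP; split=> // e eP; exists P => //; split=> //; exists S. Qed.

End ends.

Arguments end_space R T : clear implicits.
Arguments end_compactification R T : clear implicits.

(* Main.v *)
(** Mapping points where [f] (or its inverse) accumulates extends [f] to a
    homeomorphism between open sets [O1] of [T1] and [O2] of [T2] whose
    complements are closed and countable and lie in [A1] and [A2]: a generic
    small square around a point of [A2] has a compact boundary missing [A2], and
    punctured discs stay connected, so one accumulation point forces
    convergence.  It remains to see that filling in a closed countable set [B]
    of interior points does not change the end compactification.  A complementary
    component of a subsurface avoiding [B] loses only points of [B]; a nested
    sequence of such components either leaves all compact sets or shrinks to a
    point of [B].  Conversely, a subsurface meeting [B] can be made disjoint from
    [B] without changing the relevant complementary component: by Baire's
    theorem, an ambient homeomorphism supported in small discs moves its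
    frontier off [B], after which small squares around the remaining points of
    [B] are cut out of its interior.  In particular neither triangulations nor
    the Schoenflies theorem are needed, although ends are defined through
    subsurfaces.  Finally, if a point of [A1] is sent to an end, a disc around it
    yields planar neighbourhoods of that end. *)

Require Import Defs.
From HB Require Import structures.
From mathcomp Require Import all_boot all_order all_algebra.
From mathcomp Require Import all_classical all_reals all_analysis.
From mathcomp Require Import lra.

Set Implicit Arguments.
Unset Strict Implicit.
Unset Printing Implicit Defensive.

Import Order.TTheory GRing.Theory Num.Theory.
Import numFieldNormedType.Exports.
Local Open Scope classical_set_scope.
Local Open Scope ring_scope.

(** * Components and compactness *)

(** Neither surface need embed in the other: points of [A1] may correspond to ends of the second
    surface and points of [A2] to ends of the first. Hence the detour through a third surface [Om],
    open in both, on which the extension of [f] is defined; the required map is the composite of one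
    filling homeomorphism with the inverse of the other. When [B] is filled in, an end of [Om]
    becomes either an end of [T] or a point of [B], so points and ends are compared through their
    neighbourhoods in [Om], up to [B], by a relation that is total on both sides and continuous in
    both directions. The obstacle is that an end of [Om] has to be written with compact subsurfaces
    of [T] that miss [B]. Cutting a small disc out of a subsurface leaves a subsurface when the disc
    is interior to it, but may fail when it meets the frontier; this is why the frontier has to be
    moved off [B] before anything is cut. Countability enters three times: generic radii exist,
    discs stay connected without [B], and Baire's theorem applies to one condition for each point of
    [B]. *)

Section general_topology.
Context {T : topologicalType}.
Implicit Types (A B C K M O V : set T) (x y : T).

Lemma compact_ind K (P : set T -> Prop) : compact K -> P set0 ->
  (forall A B, P A -> P B -> P (A `|` B)) ->
  (forall x, K x -> exists2 V, nbhs x V & P V) ->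
  exists2 V, K `<=` V & P V.
Proof.
move=> /compact_near_coveringP cK P0 PU PK.
(* Near-covering by this filter, for the relation [i <> x], says that [K] misses the complement of
   some set with [P]. *)
pose F : set_system T := [set A | exists2 V, P V & ~` V `<=` A].
have FF : Filter F.
  split; first by exists set0.
  - move=> A B [V PV VA] [W PW WB]; exists (V `|` W); first exact: PU.
    by rewrite setCU => z [Vz Wz]; split; [exact: VA|exact: WB].
  - by move=> A B AB [V PV VA]; exists V => //; exact: subset_trans AB.
have [|V PV VK] := cK T F (fun i x => x <> i) FF.
  move=> x /PK[V xV PV]; exists (V, ~` V); first by split => //; exists V.
  by move=> [y i] /= [Vy nVi] yi; apply: nVi; rewrite -yi.
exists V => // x Kx; apply: contrapT => nVx.
exact: (VK x nVx x Kx erefl).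
Qed.

(** This form with ambient open sets serves to trap a connected set: if it misses the boundary of a
    square and meets the inside, it stays inside. *)
Lemma connectedE A : connected A <-> forall O1 O2, open O1 -> open O2 ->
  A `<=` O1 `|` O2 -> A `&` O1 `&` O2 = set0 -> A `&` O1 !=set0 -> A `<=` O1.
Proof.
split=> [cA O1 O2 oO1 oO2 AO AOO AO1|cA B B0 [C oC BC] [D cD BD]].
  have <- : A `&` O1 = A; last by move=> x [].
  apply: cA => //; first by exists O1.
  exists (~` O2); first exact: open_closedC.
  apply/seteqP; split=> x [Ax Ox]; split=> //.
  - move=> O2x; suff : set0 x by [].
    by rewrite -AOO.
  - by have [] := AO _ Ax.
have : A `<=` C.
  apply: (cA C (~` D)) => //; first exact: closed_openC.
  - move=> x Ax; have [Dx|] := pselect (D x); last by right.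
    left; have : B x by rewrite BD.
    by rewrite BC => -[].
  - apply/seteqP; split=> // x [ACx nDx].
    by apply: nDx; move: ACx; rewrite -BC BD => -[].
  - by rewrite -BC.
by rewrite BC => /setIidPl.
Qed.

Lemma connected_between A B : connected A -> A `<=` B -> B `<=` closure A ->
  connected B.
Proof.
move=> /connectedE cA AB BA; apply/connectedE => O1 O2 oO1 oO2 BO BOO [x [Bx O1x]].
have AO1 : A `<=` O1.
  apply: (cA O1 O2) => //.
  - exact: subset_trans BO.
  - apply/seteqP; split=> // y [[Ay O1y] O2y]; rewrite -BOO; split=> //.
    by split=> //; exact: AB.
  - have [z [Az O1z]] := BA _ Bx _ (open_nbhs_nbhs (conj oO1 O1x)).
    by exists z.
move=> y By; have [//|O2y] := BO _ By.
have [z [Az O2z]] := BA _ By _ (open_nbhs_nbhs (conj oO2 O2y)).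
have : set0 z by rewrite -BOO; split => //; split; [exact: AB|exact: AO1].
by [].
Qed.

Lemma is_component_sub A M : is_component A M -> M `<=` A.
Proof. by move=> [x _ ->]; exact: connected_component_sub. Qed.

Lemma is_component_connected A M : is_component A M -> connected M.
Proof. by move=> [x _ ->]; exact: component_connected. Qed.

Lemma is_component_neq0 A M : is_component A M -> M !=set0.
Proof.
by move=> [x Ax ->]; exists x; exact: connected_component_refl.
Qed.

Lemma is_component_max A M C : is_component A M -> connected C -> C `<=` A ->
  C `&` M !=set0 -> C `<=` M.
Proof.
move=> [x Ax ->] cC CA [y [Cy My]] z Cz.
by apply: connected_component_trans My _; exists C.
Qed.

Lemma is_component_maxP A M : M !=set0 -> M `<=` A -> connected M ->
  (forall C, connected C -> C `<=` A -> C `&` M !=set0 -> C `<=` M) ->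
  is_component A M.
Proof.
move=> [x Mx] MA cM Mmax; exists x; first exact: MA.
apply/seteqP; split; first exact: connected_component_max.
apply: Mmax; first exact: component_connected.
- exact: connected_component_sub.
- by exists x; split => //; apply: connected_component_refl; exact: MA.
Qed.

Lemma clopen_is_component A M : M !=set0 -> M `<=` A -> connected M ->
  open M -> closure M `&` A `<=` M -> is_component A M.
Proof.
move=> M0 MA cM oM clM; apply: is_component_maxP => // C /connectedE cC CA CM.
apply: (cC M (~` closure M)) => //.
- by apply: closed_openC; exact: closed_closure.
- move=> z Cz; have [clz|] := pselect (closure M z); last by right.
  by left; apply: clM; split => //; exact: CA.
- apply/seteqP; split=> // z [[_ Mz] nMz]; apply: nMz.
  exact: subset_closure.
Qed.

Definition locally_connected := forall x V, nbhs x V ->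
  exists W, [/\ open W, W x, W `<=` V & connected W].

Definition locally_compact_space := forall x V, nbhs x V ->
  exists K, [/\ compact K, nbhs x K & K `<=` V].

Lemma is_component_open A M : locally_connected -> open A ->
  is_component A M -> open M.
Proof.
move=> lcT oA AM; rewrite openE => x Mx; rewrite /interior nbhsE.
have [W [oW Wx WA cW]] :=
  lcT x A (open_nbhs_nbhs (conj oA (is_component_sub AM Mx))).
by exists W => //; apply: is_component_max AM cW WA _; exists x.
Qed.

Lemma is_component_closure A M : locally_connected -> open A ->
  is_component A M -> closure M `&` A `<=` M.
Proof.
move=> lcT oA AM x [clMx Ax].
have [W [oW Wx WA cW]] := lcT x A (open_nbhs_nbhs (conj oA Ax)).
apply: (is_component_max AM cW WA) => //.
have [y [My Wy]] := clMx W (open_nbhs_nbhs (conj oW Wx)).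
by exists y.
Qed.

End general_topology.
Arguments locally_connected : clear implicits.
Arguments locally_compact_space : clear implicits.

(** The first hypothesis says that [X] carries the topology induced by [j]. *)
Lemma connected_preimage (X Y : topologicalType) (j : X -> Y) (C : set Y) :
  (forall O, open O -> exists2 O', open O' & O = j @^-1` O') ->
  connected C -> C `<=` range j -> connected (j @^-1` C).
Proof.
move=> indj /connectedE cC Cj; apply/connectedE.
move=> _ _ /indj[V1 oV1 ->] /indj[V2 oV2 ->].
move=> CO COO [x [Cx O1x]] y; apply: (cC _ _ oV1 oV2).
- by move=> _ /[dup] /Cj [z _ <-]; exact: CO.
- apply/seteqP; split=> // w [[+ O1w] O2w] => /[dup] /Cj[z _ zw] Cw.
  have : set0 z by rewrite -COO /=; split; [split|]; rewrite /preimage/= zw.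
  by [].
- by exists (j x).
Qed.

(** * Charts on subsets *)

Section homeo_on.

Definition continuous_on (X Y : topologicalType) (A : set X) (f : X -> Y) :=
  forall x, A x -> forall V, nbhs (f x) V -> \forall y \near x, A y -> V (f y).

Lemma continuous_onP (X Y : topologicalType) (A : set X) (f : X -> Y) :
  continuous_on A f <-> {within A, continuous f}.
Proof. by split => [cf|/subspace_continuousP cf]; first exact/subspace_continuousP. Qed.

Lemma continuous_on_sub (X Y : topologicalType) (A B : set X) (f : X -> Y) :
  A `<=` B -> continuous_on B f -> continuous_on A f.
Proof.
move=> AB cf x Ax V fxV; have := cf x (AB _ Ax) V fxV.
by apply: filterS => y BV Ay; apply: BV; exact: AB.
Qed.

Lemma continuous_on_comp (X Y Z : topologicalType) (A : set X) (B : set Y)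
    (f : X -> Y) (g : Y -> Z) : (forall x, A x -> B (f x)) ->
  continuous_on A f -> continuous_on B g -> continuous_on A (g \o f).
Proof.
move=> AB cf cg x Ax V gfxV; have := cf x Ax _ (cg _ (AB _ Ax) V gfxV).
by apply: filterS => y fy Ay; apply: fy => //; exact: AB.
Qed.

Lemma continuous_on_open_preimage (X Y : topologicalType) (A : set X)
    (f : X -> Y) (U : set Y) : continuous_on A f -> open U ->
  exists2 V, open V & forall x, A x -> V x <-> U (f x).
Proof.
move=> cf oU; exists (interior [set x | A x -> U (f x)]).
  exact: open_interior.
move=> x Ax; split; first by move/interior_subset; exact.
by move=> Ux; apply: (cf _ Ax); exact: (open_nbhs_nbhs (conj oU Ux)).
Qed.

Lemma continuous_continuous_on (X Y : topologicalType) (A : set X) (f : X -> Y) :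
  continuous f -> continuous_on A f.
Proof.
move=> cf x _ V fxV; have : nbhs x (f @^-1` V) by exact: cf.
by apply: filterS.
Qed.

Lemma continuous_on_compact (X Y : topologicalType) (A : set X) (f : X -> Y) :
  continuous_on A f -> compact A -> compact (f @` A).
Proof. by move=> /continuous_onP; exact: continuous_compact. Qed.

Lemma continuous_on_connected (X Y : topologicalType) (A : set X) (f : X -> Y) :
  continuous_on A f -> connected A -> connected (f @` A).
Proof. by move=> /continuous_onP cf cA; exact: connected_continuous_connected. Qed.

(** The maps are total, with arbitrary values off [A] and [B], so that charts compose and restrict
    without passing through subtypes. *)
Definition homeo_on (X Y : topologicalType) (A : set X) (B : set Y) a b :=
  [/\ forall x, A x -> B (a x) /\ b (a x) = x,
      forall y, B y -> A (b y) /\ a (b y) = y,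
      continuous_on A a & continuous_on B b].

Lemma homeo_on_sym (X Y : topologicalType) (A : set X) (B : set Y) a b :
  homeo_on A B a b -> homeo_on B A b a.
Proof. by case. Qed.

Lemma homeo_on_trans (X Y Z : topologicalType) (A : set X) (B : set Y)
    (C : set Z) a b c d :
  homeo_on A B a b -> homeo_on B C c d -> homeo_on A C (c \o a) (b \o d).
Proof.
move=> [AB BA ca cb] [BC CB cc cd]; split.
- by move=> x /AB[/BC[Cc dc] ba] /=; rewrite dc.
- by move=> z /CB[/BA[Ab ab] cdz] /=; rewrite ab.
- by apply: (continuous_on_comp _ ca cc) => x /AB[].
- by apply: (continuous_on_comp _ cd cb) => x /CB[].
Qed.

Lemma homeo_on_restrict (X Y : topologicalType) (A C : set X) (B D : set Y) a b :
  homeo_on A B a b -> (forall y, B y -> D y <-> C (b y)) ->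
  homeo_on (A `&` C) (B `&` D) a b.
Proof.
move=> [AB BA ca cb] DC; split.
- move=> x [/AB[Bax bax] Cx]; split=> //; split=> //.
  by apply/DC => //; rewrite bax.
- move=> y [By Dy]; have [Ab aby] := BA _ By.
  by split=> //; split=> //; exact/DC.
- by apply: continuous_on_sub ca => x [].
- by apply: continuous_on_sub cb => x [].
Qed.

Lemma homeo_on_compact (X Y : topologicalType) (A : set X) (B : set Y) a b :
  homeo_on A B a b -> compact A -> compact B.
Proof.
move=> [AB BA ca _] /(continuous_on_compact ca); congr compact.
apply/seteqP; split => [_ [x /AB[Bx _] <-]//|y /BA[Ab aby]].
by exists (b y).
Qed.

(* [x0] and [y0] are junk values outside of the subspaces. *)
Lemma homeomorphic_homeo_on (X Y : topologicalType) (A : set X) (B : set Y)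
    (x0 : X) (y0 : Y) : homeomorphic A B ->
  exists a b, homeo_on A B a b.
Proof.
move=> [f [cf [g [cg fK gK]]]].
exists ('valL_ y0 (val \o f)), ('valL_ x0 (val \o g)).
have aE (x : X) (Ax : x \in A) : 'valL_ y0 (val \o f) x = val (f (exist _ x Ax)).
  by have := congr1 (fun h => h (exist _ x Ax)) (@valLK _ _ y0 A (val \o f)).
have bE (y : Y) (By : y \in B) : 'valL_ x0 (val \o g) y = val (g (exist _ y By)).
  by have := congr1 (fun h => h (exist _ y By)) (@valLK _ _ x0 B (val \o g)).
have gv (z : B) (By : val z \in B) : g (exist _ (val z) By) = g z.
  by congr g; exact: val_inj.
have fv (z : A) (Ay : val z \in A) : f (exist _ (val z) Ay) = f z.
  by congr f; exact: val_inj.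
split.
- move=> x /mem_set Ax; rewrite aE; split; first by apply: set_mem; exact: valP.
  by rewrite (bE _ (valP _)) gv fK.
- move=> y /mem_set By; rewrite bE; split; first by apply: set_mem; exact: valP.
  by rewrite (aE _ (valP _)) fv gK.
- apply/continuous_onP/subspace_valL_continuousP' => x.
  by apply: continuous_comp; [exact: cf|exact: initial_continuous].
- apply/continuous_onP/subspace_valL_continuousP' => x.
  by apply: continuous_comp; [exact: cg|exact: initial_continuous].
Qed.

Lemma continuous_subtype (X Y : topologicalType) (B : set Y) (f : X -> B) :
  continuous (val \o f) -> continuous f.
Proof.
move=> cf; apply/continuousP => _ [V oV <-].
by move/continuousP: cf => /(_ _ oV).
Qed.

Lemma homeo_on_homeomorphic (X Y : topologicalType) (A : set X) (B : set Y) a b :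
  homeo_on A B a b -> homeomorphic A B.
Proof.
move=> [AB BA ca cb].
have aB (x : A) : a (val x) \in B.
  by apply: mem_set; apply: (AB _ _).1; apply: set_mem; exact: valP.
have bA (x : B) : b (val x) \in A.
  by apply: mem_set; apply: (BA _ _).1; apply: set_mem; exact: valP.
exists (fun x => SigSub (aB x)); split.
  apply: continuous_subtype.
  by move/continuous_onP/subspace_sigL_continuousP : ca.
exists (fun x => SigSub (bA x)); split.
- apply: continuous_subtype.
  by move/continuous_onP/subspace_sigL_continuousP : cb.
- by move=> x; apply: val_inj => /=; apply: (AB _ _).2; apply: set_mem; exact: valP.
- by move=> x; apply: val_inj => /=; apply: (BA _ _).2; apply: set_mem; exact: valP.
Qed.

End homeo_on.

(** * The chart condition at a point, and compact subsurfaces *)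

Section surface_charts.
Context (R : realType).

(** The chart condition at one point for the topology induced on [S]. Being local, it can be checked
    by cases on the position of the point. *)
Definition surface_at (T : topologicalType) (S : set T) (x : T) :=
  exists (U : set T) (W : set (R * R)) a b,
    [/\ open U, U x, open W & homeo_on (S `&` U) (W `&` half_plane R) a b].

Lemma surface_at_homeo (X Y : topologicalType) (A : set X) (B : set Y) a b y :
  homeo_on A B a b -> B y -> surface_at A (b y) -> surface_at B y.
Proof.
move=> AB By [U [W [c [d [oU Ux oW UW]]]]]; have [_ BA _ cb] := AB.
have [V oV VU] := continuous_on_open_preimage cb oU.
exists V, W, (c \o b), (a \o d); split => //; first exact/VU.
by apply: homeo_on_trans UW; apply/homeo_on_sym; exact: homeo_on_restrict VU.
Qed.

Lemma surface_at_local (T : topologicalType) (S S' U : set T) x :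
  open U -> U x -> S `&` U = S' `&` U -> surface_at S x -> surface_at S' x.
Proof.
move=> oU Ux SU [V [W [a [b [oV Vx oW /[dup] VW [_ _ _ cb]]]]]].
have [W' oW' W'U] := continuous_on_open_preimage cb oU.
exists (V `&` U), (W `&` W'), a, b; split=> //; [exact: openI| exact: openI|].
rewrite (setIC V) setIA -SU -!setIA (setIC W') !setIA.
rewrite -setIA (setIC U) setIA.
by apply: homeo_on_restrict VW _.
Qed.

Lemma homeo_on_val (T : topologicalType) (S U : set T) (s0 : S) :
  homeo_on (S `&` U) (val @^-1` U : set S) (insubd s0) val.
Proof.
have iK y : S y -> val (insubd s0 y) = y.
  by move=> Sy; rewrite insubdK//; exact/mem_set.
split.
- by move=> x [Sx Ux]; rewrite /preimage /= iK.
- move=> y Uy; split; first by split => //; exact: set_mem (valP y).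
  by apply: val_inj; rewrite iK//; exact: set_mem (valP y).
- move=> x [Sx Ux] V [_ [[V' oV' <-] /= V'x V'V]].
  have {}V'x : V' x by rewrite -(iK _ Sx).
  have : nbhs x V' by exact: open_nbhs_nbhs.
  by apply: filterS => y V'y [Sy Uy]; apply: V'V;
    rewrite -(iK _ Sy) in V'y.
- by apply: continuous_continuous_on; exact: initial_continuous.
Qed.

Lemma surface_surface_at (T : topologicalType) (S : set T) :
  surface R S -> forall x, S x -> surface_at S x.
Proof.
move=> [_ _ sS] x Sx; pose s0 : S := exist _ x (mem_set Sx).
have [_ [[U oU <-] /= Ux] [W oW hUW]] := sS s0.
have [a [b UW]] := homeomorphic_homeo_on s0 (0 : R * R) hUW.
exists U, W, (a \o insubd s0), (val \o b); split => //.
exact: homeo_on_trans (homeo_on_val _ s0) UW.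
Qed.

Lemma compact_subtype (T : topologicalType) (S : set T) :
  compact S -> compact [set: S].
Proof.
move=> cS F FF _; have [|x [Sx clx]] := cS (val @ F) _.
  by apply: nearW => z; exact: set_mem (valP z).
exists (exist _ x (mem_set Sx)); split => // A B FA [_ [[V oV <-] /= Vx VB]].
have FvA : F (val @^-1` (val @` A)) by apply: filterS FA => z Az; exists z.
have [_ [[z Az <-] Vz]] := clx (val @` A) V FvA (open_nbhs_nbhs (conj oV Vx)).
by exists z; split => //; exact: VB.
Qed.

Lemma compact_paracompact (T : topologicalType) :
  compact [set: T] -> paracompact T.
Proof.
move=> cT C oC CT.
have [||x _|V] := @compact_ind _ _ (fun V => exists D : set (set T),
    [/\ finite_set D, D `<=` C & V `<=` \bigcup_(B in D) B]) cT.
- by exists set0; split.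
- move=> A B [D [fD DC AD]] [E [fE EC BE]]; exists (D `|` E); split.
  + by rewrite finite_setU.
  + by rewrite subUset.
  + by rewrite bigcup_setU; exact: setUSS.
- have [A CA Ax] : (\bigcup_(A in C) A) x by rewrite CT.
  exists A; first exact: open_nbhs_nbhs (conj (oC _ CA) Ax).
  exists [set A]; split; [exact: finite_set1|by move=> _ ->|].
  by rewrite bigcup_set1.
move=> TV [D [fD DC VD]]; exists D; split.
- exact: subset_trans oC.
- by apply/seteqP; split=> // x _; apply: VD; exact: TV.
- by move=> B /DC CB; exists B.
- move=> x; exists setT; first exact: filterT.
  by apply: (sub_finite_set _ fD) => B [].
Qed.

Lemma hausdorff_subtype (T : topologicalType) (S : set T) :
  hausdorff_space T -> hausdorff_space S.
Proof.
move=> hT x y xy; apply: val_inj; apply: hT => A B xA yB.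
have [z [Az Bz]] : (val @^-1` A : set S) `&` (val @^-1` B) !=set0.
  by apply: xy; exact: initial_continuous.
by exists (val z).
Qed.

Lemma compact_surface (T : topologicalType) (S : set T) :
  hausdorff_space T -> compact S -> (forall x, S x -> surface_at S x) ->
  surface R S.
Proof.
move=> hT cS sS; split; first exact: hausdorff_subtype.
  by apply: compact_paracompact; exact: compact_subtype.
move=> x; have [U [W [a [b [oU Ux oW UW]]]]] := sS _ (set_mem (valP x)).
exists (val @^-1` U); first by split => //; exists U.
exists W => //.
exact: homeo_on_homeomorphic (homeo_on_trans (homeo_on_sym (homeo_on_val U x)) UW).
Qed.

(** Separation is inherited from the ambient space and paracompactness follows from compactness, so
    only charts remain to be checked. *)
Lemma compact_subsurfaceP (T : topologicalType) (S : set T) :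
  hausdorff_space T -> compact_subsurface R S <->
  compact S /\ forall x, S x -> surface_at S x.
Proof.
move=> hT; split=> -[cS sS]; split => //; first exact: surface_surface_at.
exact: compact_surface.
Qed.

Lemma compact_subsurface_homeo (X Y : topologicalType) (A : set X) (B : set Y)
    a b : hausdorff_space X -> hausdorff_space Y ->
  homeo_on A B a b -> compact_subsurface R A -> compact_subsurface R B.
Proof.
move=> hX hY AB /(compact_subsurfaceP _ hX)[cA sA].
apply/compact_subsurfaceP => //; split; first exact: homeo_on_compact AB cA.
move=> y By; apply: (surface_at_homeo AB By); apply: sA.
by case: AB => _ /(_ _ By)[].
Qed.

End surface_charts.

(** * Squares in the plane *)

Lemma continuous_pair (X Y Z : topologicalType) (f : X -> Y) (g : X -> Z) :
  continuous f -> continuous g -> continuous (fun x => (f x, g x)).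
Proof. by move=> cf cg x; exact: (cvg_pair (cf x) (cg x)). Qed.

Section plane.
Context (R : realType).
Implicit Types (B C : set (R * R)) (I J X Y : set R) (p q v : R * R).

(** A countable set is Lebesgue-null, whereas the interval has measure [b - a]. *)
Lemma itv_not_countable (a b : R) X : a < b -> countable X ->
  exists x, [/\ a < x, x < b & ~ X x].
Proof.
move=> ab cX; apply: contrapT => H.
have : countable (`]a, b[%classic : set R).
  apply: sub_countable cX; apply: subset_card_le => x /=.
  rewrite in_itv/= => /andP[ax xb]; apply: contrapT => nXx.
  by apply: H; exists x.
move=> /countable_lebesgue_measure0; rewrite lebesgue_measure_itv/= lte_fin ab.
by rewrite -EFinB => -[] /eqP; rewrite subr_eq0 => /eqP ba; rewrite ba ltxx in ab.
Qed.

(** If [x <= a], there is room in [I] on the right of [x], towards [b]; otherwise there is room on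
    its left, towards [a]. *)
Lemma interval_dense I X (x e : R) : is_interval I ->
  (exists a b, [/\ a < b, I a & I b]) -> countable X -> I x -> 0 < e ->
  exists y, [/\ I y, ~ X y & `|x - y| < e].
Proof.
move=> iI [a [b [ab Ia Ib]]] cX Ix e0.
have [xa|ax] := leP x a.
  have xb : x < b by exact: le_lt_trans ab.
  have [y [xy yb nXy]] : exists y, [/\ x < y, y < Num.min b (x + e) & ~ X y].
    by apply: itv_not_countable => //; rewrite lt_min xb ltrDl.
  move: yb; rewrite lt_min => /andP[yb ye]; exists y; split => //.
    by apply: (iI _ _ Ix Ib); rewrite !ltW.
  by rewrite distrC gtr0_norm ?subr_gt0// ltrBlDl.
have [y [ay yx nXy]] : exists y, [/\ Num.max a (x - e) < y, y < x & ~ X y].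
  by apply: itv_not_countable => //; rewrite gt_max ax ltrBlDr ltrDl.
move: ay; rewrite gt_max => /andP[ay ye]; exists y; split => //.
  by apply: (iI _ _ Ia Ix); rewrite !ltW.
by rewrite gtr0_norm ?subr_gt0// ltrBlDl -ltrBlDr.
Qed.

(* The lines [x = c] with [c] outside of the countable projection of [B], tied
   together by one such horizontal line, form a connected dense subset. *)
Lemma connected_setXD I J B : is_interval I -> is_interval J ->
  (exists a b, [/\ a < b, I a & I b]) -> (exists a b, [/\ a < b, J a & J b]) ->
  countable B -> connected (I `*` J `\` B).
Proof.
move=> iI iJ nI nJ cB.
pose X := fst @` B; pose Y := snd @` B.
have cX : countable X by apply: sub_countable cB; exact: card_image_le.
have cY : countable Y by apply: sub_countable cB; exact: card_image_le.
have [a [_ [_ Ia _]]] := nI; have [c [_ [_ Jc _]]] := nJ.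
have [x0 [Ix0 nXx0 _]] := interval_dense iI nI cX Ia ltr01.
have [y0 [Jy0 nYy0 _]] := interval_dense iJ nJ cY Jc ltr01.
have cfst (y : R) : continuous (fun x : R => (x, y)).
  by apply: continuous_pair => x; [exact: cvg_id|exact: cvg_cst].
have csnd (x : R) : continuous (fun y : R => (x, y)).
  by apply: continuous_pair => y; [exact: cvg_cst|exact: cvg_id].
pose cross x : set (R * R) := (pair x @` J) `|` ((fun z => (z, y0)) @` I).
pose H := \bigcup_(x in I `\` X) cross x.
apply: (@connected_between _ H).
- apply: bigcup_connected; first by exists (x0, y0) => x [Ix _]; right; exists x0.
  move=> x [Ix nXx]; apply: connectedU.
  + by exists (x, y0); split; [exists y0|exists x].
  + apply: continuous_on_connected; first exact: continuous_continuous_on.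
    exact/connected_intervalP.
  + apply: continuous_on_connected; first exact: continuous_continuous_on.
    exact/connected_intervalP.
- move=> p [x [Ix nXx] [] [z Jz <-]]; split => //.
  + by move=> Bxz; apply: nXx; exists (x, z).
  + by move=> Bxz; apply: nYy0; exists (z, y0).
- move=> [x y] [[/= Ix Jy] _] V /nbhs_ballP[e e0 eV].
  have [z [Iz nXz xz]] := interval_dense iI nI cX Ix e0.
  exists (z, y); split; first by exists z => //; left; exists y.
  by apply: eV; split => //=; exact: ballxx.
Qed.

(** The norm of a product is the maximum of the two norms, so balls are squares, that is, products
    of intervals. *)
Definition sq (r : R) : set (R * R) := [set p | `|p| < r].
Definition csq (r : R) : set (R * R) := [set p | `|p| <= r].

Lemma norm_pairE p : `|p| = Num.max `|p.1| `|p.2|. Proof. by []. Qed.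

Lemma open_sq r : open (sq r).
Proof.
rewrite (_ : sq r = Num.norm @^-1` [set x | x < r])//.
by apply: open_comp; [move=> p _; exact: norm_continuous|exact: open_lt].
Qed.

Lemma sqE r : sq r = `]- r, r[%classic `*` `]- r, r[%classic.
Proof.
apply/seteqP; split=> -[x y] /=; rewrite /sq /= norm_pairE gt_max !ltr_norml !in_itv/=.
  by move=> /andP[].
by move=> [-> ->].
Qed.

Lemma csqE r : csq r = `[- r, r]%classic `*` `[- r, r]%classic.
Proof.
apply/seteqP; split=> -[x y] /=; rewrite /csq /= norm_pairE ge_max !ler_norml !in_itv/=.
  by move=> /andP[].
by move=> [-> ->].
Qed.

Lemma compact_csq r : compact (csq r).
Proof. by rewrite csqE; apply: compact_setX; exact: segment_compact. Qed.

Lemma connected_sqD r B : 0 < r -> countable B -> connected (sq r `\` B).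
Proof.
move=> r0 cB; rewrite sqE.
have rI : exists a b, [/\ a < b, a \in `]- r, r[ & b \in `]- r, r[].
  by exists 0, (r / 2); rewrite !in_itv/=; split; lra.
by apply: connected_setXD => //; exact: interval_is_interval.
Qed.

(** The norms of the points of [B] are countable in number. This is the source of all generic
    squares: their boundary misses [B]. *)
Lemma generic_radius (a b : R) B : a < b -> countable B ->
  exists r, [/\ a < r, r < b & forall p, B p -> `|p| != r].
Proof.
move=> ab cB; have cN : countable (Num.norm @` B : set R).
  by apply: sub_countable cB; exact: card_image_le.
have [r [ar rb nB]] := itv_not_countable ab cN.
by exists r; split => // p Bp; apply/eqP => pr; apply: nB; exists p.
Qed.

End plane.
Arguments open_sq : clear implicits.
Arguments compact_csq : clear implicits.

(** * Regions bounded by a square are surfaces *)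

Section square_regions.
Context (R : realType).
Implicit Types (S : set (R * R)) (p q : R * R).

Let cfst : continuous (fst : R * R -> R). Proof. by move=> p; exact: cvg_fst. Qed.
Let csnd : continuous (snd : R * R -> R). Proof. by move=> p; exact: cvg_snd. Qed.

Lemma surface_at_interior S p : nbhs p S -> surface_at R S p.
Proof.
rewrite nbhsE => -[V [oV Vp] VS].
(* This translation places [p] at height 1; [U] below keeps only points that land strictly above the
   axis, so the half plane imposes nothing. *)
pose a q : R * R := (q.1, q.2 - p.2 + 1).
pose b q : R * R := (q.1, q.2 + p.2 - 1).
have ca : continuous a.
  apply: continuous_pair => // q.
  by apply: cvgD; [apply: cvgB; [exact: csnd|exact: cvg_cst]|exact: cvg_cst].
have cb : continuous b.
  apply: continuous_pair => // q.
  by apply: cvgB; [apply: cvgD; [exact: csnd|exact: cvg_cst]|exact: cvg_cst].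
have ab q : a (b q) = q by rewrite /a /b /=; case: q => x y /=; congr pair; lra.
have ba q : b (a q) = q by rewrite /a /b /=; case: q => x y /=; congr pair; lra.
pose U := V `&` (snd @^-1` [set y | p.2 - 1 < y]).
have oU : open U.
  by apply: openI => //; apply: open_comp; [move=> q _; exact: csnd|exact: open_gt].
have US : S `&` U = U by apply/setIidPr => q [/VS].
have WH : b @^-1` U `&` half_plane R = b @^-1` U.
  by apply/setIidPl => q [_]; rewrite /b /half_plane /=; lra.
exists U, (b @^-1` U), a, b; split => //.
- by split => //=; lra.
- by apply: open_comp => // q _; exact: cb.
- rewrite US WH; split.
  + by move=> q Uq; split => //; rewrite /preimage/= ba.
  + by [].
  + exact: continuous_continuous_on.
  + exact: continuous_continuous_on.
Qed.

(** The larger of two absolute values is the sum of the absolute values of the half-sum and the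
    half-difference; on the wedge the half-difference is positive. *)
Lemma norm_wedge p : p.2 < p.1 ->
  `|p| = `|(p.1 + p.2) / 2| + (p.1 - p.2) / 2.
Proof.
move=> p21; rewrite norm_pairE; case: (leP `|p.1| `|p.2|) => + ;
  by have [?|?] := ger0P p.1; have [?|?] := ger0P p.2;
    have [?|?] := ger0P ((p.1 + p.2) / 2) => ?; lra.
Qed.

(** The sign [s] selects the side: 1 for the outside of the square, -1 for the inside. Both sides
    are then treated at once. *)
Definition square_region (r s : R) : set (R * R) := [set p | 0 <= s * (`|p| - r)].

(* On the wedge [p.2 < p.1] the norm is an affine function of [p.1 - p.2] for a
   fixed [p.1 + p.2], which straightens the corner of the square. *)
Lemma surface_at_wedge r s p : s * s = 1 -> p.2 < p.1 ->
  surface_at R (square_region r s) p.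
Proof.
move=> s2 p21.
pose a q : R * R := ((q.1 + q.2) / 2, s * (`|q| - r)).
(* In the coordinates given by [a], this recovers the half-difference from the half-sum and the
   signed distance, by [norm_wedge] and [s * s = 1]; the wedge becomes the set where it is
   positive. *)
pose v q : R := r + s * q.2 - `|q.1|.
pose b q : R * R := (q.1 + v q, q.1 - v q).
have cv : continuous v.
  move=> q; apply: cvgB; last first.
    by apply: continuous_comp; [exact: cfst|exact: norm_continuous].
  apply: cvgD; first exact: cvg_cst.
  by apply: cvgM; [exact: cvg_cst|exact: csnd].
have ca : continuous a.
  apply: continuous_pair => q.
    by apply: cvgM; [apply: cvgD; [exact: cfst|exact: csnd]|exact: cvg_cst].
  apply: cvgM; first exact: cvg_cst.
  by apply: cvgB; [exact: norm_continuous|exact: cvg_cst].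
have cb : continuous b.
  apply: continuous_pair => q.
    by apply: cvgD; [exact: cfst|exact: cv].
  by apply: cvgB; [exact: cfst|exact: cv].
have oU : open [set q : R * R | q.2 < q.1].
  rewrite (_ : mkset _ = (fun q => q.1 - q.2) @^-1` [set x | 0 < x]).
    apply: open_comp; last exact: open_gt.
    by move=> q _; apply: cvgB; [exact: cfst|exact: csnd].
  by apply/seteqP; split=> q /=; rewrite subr_gt0.
exists [set q | q.2 < q.1], [set q | 0 < v q], a, b; split => //.
- apply: (@open_comp _ _ v [set x | 0 < x]); last exact: open_gt.
  by move=> q _; exact: cv.
have ss x : s * (s * x) = x by rewrite mulrA s2 mul1r.
split.
- move=> q [Sq q21]; have nq := norm_wedge q21.
  have vE : v (a q) = (q.1 - q.2) / 2 by rewrite /v /a /= ss nq; lra.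
  split; last by rewrite /b vE; case: q {nq vE Sq} q21 => x y /= _; congr pair; lra.
  by split => //=; rewrite vE; move: q21 => /=; lra.
- move=> q [/= vq Hq].
  have b21 : (b q).2 < (b q).1 by rewrite /b /=; lra.
  have nb : `|b q| = `|q.1| + v q.
    rewrite (norm_wedge b21) /b /=.
    by rewrite (_ : (q.1 + v q + (q.1 - v q)) / 2 = q.1); lra.
  have sE : s * (`|b q| - r) = q.2.
    by rewrite nb /v -[RHS]ss; congr (s * _); lra.
  split; first by split => //; rewrite /square_region /= sE.
  by rewrite /a sE /b /=; case: (q) => x y /=; congr pair; lra.
- exact: continuous_continuous_on.
- exact: continuous_continuous_on.
Qed.

(** The images of the wedge under the swap and the two reflections, all isometries, cover the plane
    without the origin. The origin belongs to the region only for [s = -1], and is then interior. *)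
Lemma surface_at_square_region r s p : 0 < r -> s * s = 1 ->
  square_region r s p -> surface_at R (square_region r s) p.
Proof.
move=> r0 s2 Sp.
have invol (g : R * R -> R * R) : continuous g -> involutive g ->
    (forall q, `|g q| = `|q|) -> surface_at R (square_region r s) (g p) ->
    surface_at R (square_region r s) p.
  move=> cg gK gN; apply: (surface_at_homeo (a := g)) => //; split.
  - by move=> q; rewrite /square_region/= gN gK.
  - by move=> q; rewrite /square_region/= gN gK.
  - exact: continuous_continuous_on.
  - exact: continuous_continuous_on.
have [lt21|le12] := ltP p.2 p.1; first exact: surface_at_wedge.
have [lt12|le21] := ltP p.1 p.2.
  apply: (invol (fun q => (q.2, q.1))); last exact: surface_at_wedge.
  - exact: continuous_pair.
  - by case.
  - by move=> q; rewrite !norm_pairE maxC.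
have [lt0|le0] := ltP 0 (p.1 + p.2).
  apply: (invol (fun q => (q.1, - q.2))); last by apply: surface_at_wedge => //=; lra.
  - by apply: continuous_pair => // q; apply: cvgN; exact: csnd.
  - by case=> x y /=; rewrite opprK.
  - by move=> q; rewrite !norm_pairE normrN.
have [lt0|ge0] := ltP (p.1 + p.2) 0.
  apply: (invol (fun q => (- q.1, q.2))); last by apply: surface_at_wedge => //=; lra.
  - by apply: continuous_pair => // q; apply: cvgN; exact: cfst.
  - by case=> x y /=; rewrite opprK.
  - by move=> q; rewrite !norm_pairE normrN.
apply: surface_at_interior.
have p0 : p = 0.
  by rewrite [p]surjective_pairing; congr pair; lra.
have s0 : s < 0 by move: Sp; rewrite p0 /square_region/= normr0; nra.
apply: (filterS (P := sq r)).
  by move=> q; rewrite /sq /square_region/= => qr; nra.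
by apply: open_nbhs_nbhs; split; [exact: open_sq|rewrite p0 /sq/= normr0].
Qed.

End square_regions.

(* Makes [R * R] a pointed uniform space, as completeness requires. *)
HB.saturate prod.

(** Completeness of the plane is what Baire's theorem requires in [disc_push]. *)
Lemma pair_cauchy_cvg (R : realType) (F : set_system (R * R)) :
  ProperFilter F -> cauchy F -> cvg F.
Proof.
move=> FF /cauchyP Fc.
have /cauchy_cvg/cvg_ex[x xF] : cauchy (fst @ F).
  apply: cauchy_exP => e e0; have [p Fp] := Fc _ e0; exists p.1.
  suff : F (fst @^-1` ball p.1 e) by [].
  by apply: filterS Fp => q [].
have /cauchy_cvg/cvg_ex[y yF] : cauchy (snd @ F).
  apply: cauchy_exP => e e0; have [p Fp] := Fc _ e0; exists p.2.
  suff : F (snd @^-1` ball p.2 e) by [].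
  by apply: filterS Fp => q [].
apply/cvg_ex; exists (x, y) => /= V [[A B] /= [xA yB] ABV].
have FA : F (fst @^-1` A) by exact: xF.
have FB : F (snd @^-1` B) by exact: yF.
by apply: filterS (filterI FA FB) => p [Ap Bp]; exact: ABV.
Qed.

HB.instance Definition _ (R : realType) := Uniform_isComplete.Build (R * R)%type
  (@pair_cauchy_cvg R).

(** * Homeomorphisms of the plane supported in a square *)

Section push.
Context (R : realType).
Implicit Types (p q v : R * R).

Definition bump p : R := Num.max 0 (1 / 2 - `|p|).
(** As [bump] is 1-Lipschitz, for [v] of norm at most 1/2 this is the identity plus a 1/2-Lipschitz
    map. For fixed [p] in the open half square it is an affine bijection in [v], which turns
    conditions on the image of [p] into generic conditions on [v]. *)
Definition push v p : R * R := p + bump p *: v.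

Lemma bump_ge0 p : 0 <= bump p. Proof. by rewrite le_max lexx. Qed.

Lemma bump_lipschitz p q : `|bump p - bump q| <= `|p - q|.
Proof.
have := ler_dist_dist p q; rewrite /bump.
move: (normr_ge0 (p - q)) (`|p - q|) => /[swap] d d0.
case: (leP 0 (1 / 2 - `|p|)) => ?; case: (leP 0 (1 / 2 - `|q|)) => ?;
  by rewrite !ler_norml => /andP[? ?]; apply/andP; split; lra.
Qed.

Lemma bump_out p : 1 / 2 <= `|p| -> bump p = 0.
Proof. by move=> p2; apply/max_idPl; rewrite subr_le0. Qed.

Lemma bump_gt0 p : `|p| < 1 / 2 -> 0 < bump p.
Proof. by move=> p2; rewrite lt_max subr_gt0 p2 orbT. Qed.

Lemma push_out v p : 1 / 2 <= `|p| -> push v p = p.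
Proof. by move=> /bump_out; rewrite /push => ->; rewrite scale0r addr0. Qed.

Lemma continuous_bump : continuous bump.
Proof.
move=> p; apply/cvgrPdist_le => e e0; near=> q.
apply: le_trans (bump_lipschitz _ _) _.
by near: q; apply: cvgr_dist_le => //; exact: cvg_id.
Unshelve. all: by end_near. Qed.

Lemma continuous_push v : continuous (push v).
Proof.
move=> p; apply: cvgD; first exact: cvg_id.
by apply: cvgZr_tmp; exact: continuous_bump.
Qed.

Lemma push_sq v p : `|v| <= 1 / 2 -> `|p| < 1 / 2 -> `|push v p| < 1 / 2.
Proof.
move=> v2 p2; apply: le_lt_trans (ler_normD _ _) _.
rewrite normrZ ger0_norm ?bump_ge0//.
have : bump p * `|v| <= bump p * (1 / 2) by rewrite ler_wpM2l// bump_ge0.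
have -> : bump p = 1 / 2 - `|p| by apply/max_idPr; rewrite subr_ge0 ltW.
by lra.
Qed.

(** The perturbation absorbs at most half of the distance. Injectivity and continuity of the inverse
    both follow. *)
Lemma push_expand v p q : `|v| <= 1 / 2 -> `|p - q| <= 2 * `|push v p - push v q|.
Proof.
move=> v2.
have pE : push v p - push v q = (p - q) + (bump p - bump q) *: v.
  by rewrite /push scalerBl opprD addrACA.
have -> : p - q = (push v p - push v q) - (bump p - bump q) *: v.
  by rewrite pE addrK.
set d := push v p - push v q in pE *.
have : `|(bump p - bump q) *: v| <= `|p - q| * (1 / 2).
  by rewrite normrZ ler_pM// bump_lipschitz.
have := ler_normB d ((bump p - bump q) *: v).
have : `|p - q| <= `|d| + `|(bump p - bump q) *: v|.
  rewrite (_ : p - q = d - (bump p - bump q) *: v) ?ler_normB//.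
  by rewrite pE addrK.
by move=> ? ? ?; lra.
Qed.

(** Points move only in the direction [v], so a preimage has the form [q - s *: v] with
    [s = bump (q - s *: v)]. Since [bump] takes values between 0 and 1/2, the intermediate value
    theorem provides [s]. *)
Lemma push_surj v q : `|v| <= 1 / 2 -> exists p, push v p = q.
Proof.
move=> v2; pose f (s : R) := s - bump (q - s *: v).
have cf : continuous f.
  move=> s; apply: cvgB; first exact: cvg_id.
  apply: (@continuous_comp _ _ _ (fun s : R => q - s *: v) bump s); last first.
    exact: continuous_bump.
  by apply: cvgB; [exact: cvg_cst|apply: cvgZr_tmp; exact: cvg_id].
have [|||s _ fs] := @IVT R f 0 (1 / 2) 0.
- by lra.
- exact: continuous_subspaceT.
- have f0 : f 0 <= 0 by rewrite /f sub0r oppr_le0 bump_ge0.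
  have f1 : 0 <= f (1 / 2).
    by rewrite subr_ge0 /bump ge_max; apply/andP; split; rewrite ?lerBlDr ?lerDl//; lra.
  by rewrite ge_min f0 /= le_max f1 orbT.
exists (q - s *: v); rewrite /push.
have -> : bump (q - s *: v) = s by apply/esym/eqP; rewrite -subr_eq0; exact/eqP.
by rewrite subrK.
Qed.

Lemma push_homeo v : `|v| <= 1 / 2 ->
  exists g, [/\ continuous g, cancel (push v) g & cancel g (push v)].
Proof.
move=> v2; have [g gE] := choice (fun q => push_surj q v2).
have gK : cancel (push v) g.
  move=> p; apply/eqP; rewrite -subr_eq0 -normr_le0.
  by have := push_expand (g (push v p)) p v2; rewrite gE subrr normr0 mulr0.
exists g; split => // p; apply/cvgrPdist_le => e e0; near=> q.
apply: le_trans (push_expand _ _ v2) _; rewrite !gE.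
rewrite -ler_pdivlMl//; near: q.
by apply: cvgr_dist_le; [exact: cvg_id|rewrite mulr_gt0 ?invr_gt0].
Unshelve. all: by end_near. Qed.

End push.

(** * Disc charts *)

Section disc_charts.
Context (R : realType) (T : topologicalType).
Implicit Types (h : R * R -> T) (k : T -> R * R) (p q v : R * R) (S O : set T).

(** Only the values of [h] on the unit square and of [k] on its image matter. As the image is open,
    [h] sends open subsets of the square to open sets of [T]. *)
Definition disc_chart h k := open (h @` sq 1) /\ homeo_on (sq 1) (h @` sq 1) h k.

Lemma disc_chartK h k p : disc_chart h k -> `|p| < 1 -> k (h p) = p.
Proof. by move=> [_ [+ _ _ _]] p1 => /(_ _ p1)[]. Qed.

Lemma disc_chart_inj h k p q : disc_chart h k -> `|p| < 1 -> `|q| < 1 ->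
  h p = h q -> p = q.
Proof. by move=> hk p1 q1 pq; rewrite -(disc_chartK hk p1) pq (disc_chartK hk). Qed.

Lemma disc_chart_image h k x : disc_chart h k -> (h @` sq 1) x ->
  `|k x| < 1 /\ h (k x) = x.
Proof. by move=> [_ [_ + _ _]] Dx => /(_ _ Dx). Qed.

Lemma disc_chart_open h k (V : set (R * R)) : disc_chart h k -> open V ->
  V `<=` sq 1 -> open (h @` V).
Proof.
move=> hk oV V1; have [oD [_ _ _ ck]] := hk.
have [W oW WV] := continuous_on_open_preimage ck oV.
rewrite (_ : h @` V = (h @` sq 1) `&` W); first exact: openI.
apply/seteqP; split=> [_ [p Vp <-]|x [Dx /(WV _ Dx) Vx]].
- have Dp : (h @` sq 1) (h p) by exists p => //; exact: V1.
  by split => //; apply/WV => //; rewrite (disc_chartK hk)//; exact: V1.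
- by exists (k x) => //; exact: (disc_chart_image hk Dx).2.
Qed.

Lemma disc_chart_compact h k (K : set (R * R)) : disc_chart h k -> compact K ->
  K `<=` sq 1 -> compact (h @` K).
Proof.
move=> [_ [_ _ ch _]] cK K1; apply: continuous_on_compact cK.
exact: continuous_on_sub ch.
Qed.

Lemma disc_chart_connected h k (C : set (R * R)) : disc_chart h k ->
  connected C -> C `<=` sq 1 -> connected (h @` C).
Proof.
move=> [_ [_ _ ch _]] cC C1; apply: continuous_on_connected cC.
exact: continuous_on_sub ch.
Qed.

Lemma interior_disc_chart x O : surface_interior R T x -> nbhs x O ->
  exists h k, [/\ disc_chart h k, h 0 = x & h @` sq 1 `<=` O].
Proof.
move=> [U [oU Ux] [W oW hUW]] xO.
have [a [b [UW WU ca cb]]] := homeomorphic_homeo_on x (0 : R * R) hUW.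
have [Wax bax] := UW _ Ux.
have : nbhs (a x) W by exact: open_nbhs_nbhs.
have : nbhs (b (a x)) O by rewrite bax.
move=> /(cb _ Wax) /filterI /[apply] /nbhs_ballP[r /= r0 rO].
pose h p := b (a x + r *: p); pose k y := r^-1 *: (a y - a x).
have rB p : `|p| < 1 -> ball (a x) r (a x + r *: p).
  move=> p1; rewrite -ball_normE /ball_/= opprD addNKr normrN normrZ gtr0_norm//.
  by rewrite -ltr_pdivlMl// mulVf// gt_eqF.
have rW p : `|p| < 1 -> W (a x + r *: p) by move=> /rB/rO[].
have hU p : `|p| < 1 -> U (h p) by move=> /rW/WU[].
have ah p : `|p| < 1 -> a (h p) = a x + r *: p by move=> /rW/WU[].
have hK p : `|p| < 1 -> k (h p) = p.
  by move=> p1; rewrite /k ah// addrC addKr scalerA mulVf ?scale1r// gt_eqF.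
have h0 : h 0 = x by rewrite /h scaler0 addr0.
have hD y : U y -> ball (a x) r (a y) -> `|k y| < 1 /\ h (k y) = y.
  move=> Uy; rewrite -ball_normE /ball_/= => ry; split.
    rewrite /k normrZ distrC gtr0_norm ?invr_gt0//.
    by rewrite -ltr_pdivlMl ?invr_gt0// invrK mulr1.
  rewrite /h /k scalerA divff ?gt_eqF// scale1r addrC subrK.
  by have [] := UW _ Uy.
have [V oV Va] := continuous_on_open_preimage ca (ball_open (a x) r).
exists h, k; split => //; last by move=> _ [p p1 <-]; have [Ob /Ob] := rO _ (rB _ p1).
split.
  rewrite (_ : h @` sq 1 = U `&` V); first exact: openI.
  apply/seteqP; split=> [_ [p p1 <-]|y [Uy /(Va _ Uy) ry]].
  - by split; [exact: hU|apply/Va; [exact: hU|rewrite ah//; exact: rB]].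
  - by exists (k y); have [] := hD _ Uy ry.
split.
- by move=> p p1; split; [exists p|exact: hK].
- by move=> _ [p p1 <-]; rewrite hK.
- apply: (continuous_on_comp (B := W) _ _ cb); first by move=> p /rW.
  apply: continuous_continuous_on => p; apply: cvgD; first exact: cvg_cst.
  by apply: cvgZl_tmp; exact: cvg_id.
- apply: (continuous_on_comp (B := setT) _ (f := a) (g := fun z => r^-1 *: (z - a x))) => //.
    by apply: continuous_on_sub ca => _ [p p1 <-]; exact: hU.
  apply: continuous_continuous_on => p; apply: cvgZl_tmp.
  by apply: cvgB; [exact: cvg_id|exact: cvg_cst].
Qed.

(** The plane model [A] has to agree with [S] only within [U], so the two boundary squares of an
    annulus can be treated separately. *)
Lemma disc_chart_surface_at h k (A : set (R * R)) S U p : disc_chart h k ->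
  `|p| < 1 -> surface_at R A p -> open U -> U (h p) -> A p ->
  (forall q, `|q| < 1 -> U (h q) -> S (h q) <-> A q) -> surface_at R S (h p).
Proof.
move=> hk p1 Ap oU Up Sp SA; have [oD [Dh Dk ch ck]] := hk.
have D_p : (h @` sq 1) (h p) by exists p.
apply: (@surface_at_local _ _ (h @` (A `&` sq 1)) _ (U `&` (h @` sq 1))) => //.
- exact: openI.
- apply/seteqP; split=> x [+ [Ux [q q1 qx]]].
    move=> [r [Ar r1] rx]; rewrite -rx in Ux *; split.
      by apply/SA.
    by split => //; exists r.
  move=> Sx; rewrite -qx in Ux Sx *; split; last by split => //; exists q.
  by exists q => //; split => //; apply/SA.
apply: (@surface_at_homeo _ _ _ (A `&` sq 1) _ h k); first split.
- by move=> q [Aq q1]; split; [exists q|exact: disc_chartK hk q1].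
- by move=> _ [q [Aq q1] <-]; rewrite (disc_chartK hk q1).
- by apply: continuous_on_sub ch => q [].
- by apply: continuous_on_sub ck => _ [q [_ q1] <-]; exists q.
- by exists p.
- rewrite (disc_chartK hk p1).
  apply: (@surface_at_local _ _ A _ (sq 1)) => //; first exact: open_sq.
  by rewrite -setIA setIid.
Qed.

End disc_charts.

(** * General position by ambient homeomorphisms *)

Lemma dependent_choice (A : Type) (P : A -> Prop) (r : nat -> A -> A -> Prop) a :
  P a -> (forall n x, P x -> exists y, r n x y /\ P y) ->
  exists u : nat -> A, u 0%N = a /\ forall n, P (u n) /\ r n (u n) (u n.+1).
Proof.
move=> Pa step.
have /choice[s sP] : forall nx : nat * {x | P x}, exists y : {x | P x},
    r nx.1 (sval nx.2) (sval y).
  by move=> [n [x Px]]; have [y [xy Py]] := step n x Px; exists (exist _ y Py).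
pose u := fix u n := if n is m.+1 then s (m, u m) else exist _ a Pa.
exists (fun n => sval (u n)); split => // n; split; first exact: svalP.
exact: (sP (n, u n)).
Qed.

Section ambient.
Context (R : realType) (T : topologicalType) (hT : hausdorff_space T).
Implicit Types (h : R * R -> T) (k : T -> R * R) (p q v : R * R).
Implicit Types (B S O V : set T).

Definition disc_extend h k (t : R * R -> R * R) (x : T) : T :=
  if `[< (h @` sq 1) x >] then h (t (k x)) else x.

Lemma disc_extendE h k t p : disc_chart h k -> `|p| < 1 ->
  disc_extend h k t (h p) = h (t p).
Proof.
move=> hk p1; rewrite /disc_extend (disc_chartK hk p1).
by case: asboolP => // -[]; exists p.
Qed.

Lemma disc_extend_out h k t x : disc_chart h k ->
  (forall p, 1 / 2 <= `|p| -> t p = p) -> ~ (h @` sq (1 / 2)) x ->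
  disc_extend h k t x = x.
Proof.
move=> hk t2 nx; rewrite /disc_extend; case: asboolP => // Dx.
have [k1 hkx] := disc_chart_image hk Dx.
rewrite t2// leNgt; apply/negP => k2; apply: nx.
by exists (k x).
Qed.

(** The open disc and the complement of the image of the closed half square cover [T]. That image is
    compact, hence closed, and off it the map is the identity. *)
Lemma continuous_disc_extend h k t : disc_chart h k -> continuous t ->
  (forall p, `|p| < 1 -> `|t p| < 1) -> (forall p, 1 / 2 <= `|p| -> t p = p) ->
  continuous (disc_extend h k t).
Proof.
move=> hk ct t1 t2 x V; have [oD [hD kD ch ck]] := hk.
have [Dx|nDx] := pselect ((h @` sq 1) x).
  have hkD y : (h @` sq 1) y -> disc_extend h k t y = h (t (k y)).
    by move=> Dy; rewrite /disc_extend; case: asboolP.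
  rewrite hkD// => xV.
  have ctk : continuous_on (h @` sq 1) (fun y => h (t (k y))).
    apply: (continuous_on_comp (B := sq 1) _ _ ch).
      by move=> y Dy; apply: t1; exact: (disc_chart_image hk Dy).1.
    apply: (continuous_on_comp (B := setT) _ ck) => //.
    exact: continuous_continuous_on.
  suff : nbhs x (disc_extend h k t @^-1` V) by [].
  apply: (filterS _ (filterI (ctk _ Dx V xV) (open_nbhs_nbhs (conj oD Dx)))).
  by move=> y [yV Dy]; rewrite /preimage/= hkD//; exact: yV.
have cQ : closed (h @` csq (1 / 2)).
  apply: compact_closed => //; apply: disc_chart_compact hk _ _.
    exact: compact_csq.
  by move=> p /= p2; apply: le_lt_trans p2 _; lra.
have nQ y : ~ (h @` csq (1 / 2)) y -> disc_extend h k t y = y.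
  move=> nQy; apply: disc_extend_out hk t2 _ => -[p p2 py]; apply: nQy.
  by exists p => //; exact: ltW.
have nQx : ~ (h @` csq (1 / 2)) x.
  move=> [p p2 px]; apply: nDx; exists p => //.
  by apply: le_lt_trans p2 _; lra.
rewrite (nQ _ nQx) => xV.
suff : nbhs x (disc_extend h k t @^-1` V) by [].
apply: (filterS _ (filterI xV (open_nbhs_nbhs (conj (closed_openC cQ) nQx)))).
by move=> y [Vy nQy]; rewrite /preimage/= nQ.
Qed.

Definition ambient_homeo (t t' : T -> T) :=
  [/\ continuous t, continuous t', cancel t t' & cancel t' t].

Lemma ambient_homeo_comp t t' s s' : ambient_homeo t t' -> ambient_homeo s s' ->
  ambient_homeo (t \o s) (s' \o t').
Proof.
move=> [ct ct' tK tK'] [cs cs' sK sK']; split.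
- by move=> x; apply: continuous_comp; [exact: cs|exact: ct].
- by move=> x; apply: continuous_comp; [exact: ct'|exact: cs'].
- exact: can_comp.
- exact: can_comp.
Qed.

Lemma disc_push h k S B : disc_chart h k -> closed S -> countable B ->
  exists t t', [/\ ambient_homeo t t',
    forall x, ~ (h @` sq (1 / 2)) x -> t x = x &
    forall b, B b -> (h @` sq (1 / 2)) b -> S (t b) -> (interior S) (t b)].
Proof.
move=> hk cS /countable_injP[f fI].
have half1 p : `|p| <= 1 / 2 -> `|p| < 1 by move=> p2; apply: le_lt_trans p2 _; lra.
pose F := S `&` ~` interior S.
have cF : closed F by apply: closedI => //; apply: open_closedC; exact: open_interior.
pose Z := k @` (F `&` h @` csq (1 / 2)).
have cQ : compact (h @` csq (1 / 2)).
  by apply: disc_chart_compact hk _ _; [exact: compact_csq|move=> p; exact: half1].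
have cZ : closed Z.
  apply: compact_closed; first exact: norm_hausdorff.
  have [_ [_ _ _ ck]] := hk; apply: continuous_on_compact.
    by apply: continuous_on_sub ck => _ [_ [p p2 <-]]; exists p => //; exact: half1.
  apply: (subclosed_compact _ cQ); last by move=> x [].
  by apply: closedI => //; exact: compact_closed.
have ZF p : Z p -> `|p| < 1 /\ F (h p).
  move=> [x [Fx [q q2 qx]] <-]; have q1 := half1 _ q2.
  by rewrite -qx (disc_chartK hk q1) qx.
(* An open part of [Z] would have an open image contained in [S], hence in its interior, which [F]
   excludes. *)
have Z0 (V : set (R * R)) : open V -> V `<=` Z -> V = set0.
  move=> oV VZ; apply/seteqP; split => // p Vp.
  have [p1 [_ nSp]] := ZF p (VZ _ Vp); apply: nSp.
  have oV' : open (h @` V) by apply: (disc_chart_open hk) => // q /VZ/ZF[].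
  have Vhp : (h @` V) (h p) by exists p.
  apply: (filterS _ (open_nbhs_nbhs (conj oV' Vhp))).
  by move=> _ [q /VZ/ZF[_ [Sq _]] <-].
(* The vectors that push the point of [B] numbered [n] off [Z]. When there is such a point in the
   half disc, this is the preimage of an open dense set under an affine bijection, as [bump (k b)]
   is positive. *)
pose G n : set (R * R) := [set v | forall b, B b -> (h @` sq (1 / 2)) b ->
  f b = n -> ~ Z (k b + bump (k b) *: v)].
have GP n : open (G n) /\ dense (G n).
  have [[b [Bb Db fb]]|nob] := pselect (exists b, [/\ B b, (h @` sq (1 / 2)) b & f b = n]);
    last first.
    rewrite (_ : G n = setT).
      by split; [exact: openT|move=> V V0 _; rewrite setIT].
    by apply/seteqP; split=> // v _ b Bb Db fb; case: nob; exists b.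
  pose l := bump (k b); pose a v : R * R := k b + l *: v.
  pose a' p : R * R := l^-1 *: (p - k b).
  have l0 : 0 < l.
    rewrite /l; have [p p2 <-] := Db; rewrite (disc_chartK hk); first exact: bump_gt0.
    by apply: lt_trans p2 _; lra.
  have aK p : a (a' p) = p by rewrite /a /a' scalerA divff ?gt_eqF// scale1r addrC subrK.
  have aK' v : a' (a v) = v.
    by rewrite /a /a' addrC addKr scalerA mulVf ?gt_eqF// scale1r.
  have ca : continuous a.
    by move=> v; apply: cvgD; [exact: cvg_cst|apply: cvgZl_tmp; exact: cvg_id].
  have ca' : continuous a'.
    by move=> v; apply: cvgZl_tmp; apply: cvgB; [exact: cvg_id|exact: cvg_cst].
  have GE : G n = a @^-1` (~` Z).
    apply/seteqP; split=> v Gv; first exact: Gv.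
    move=> b' Bb' Db' fb'; rewrite (_ : b' = b)//.
    by apply: fI; rewrite ?inE ?fb' ?fb.
  rewrite GE; split.
    by apply: open_comp; [move=> v _; exact: ca|exact: closed_openC].
  move=> V [v Vv] oV; apply: contrapT => nV.
  have : a' @^-1` V = set0.
    apply: Z0; first by apply: open_comp => // p _; exact: ca'.
    move=> p Vp; apply: contrapT => nZp; apply: nV; exists (a' p); split => //.
    by rewrite /preimage /= aK.
  by move=> /seteqP[+ _] => /(_ (a v)); apply; rewrite /preimage/= aK'.
(* One vector serves all points of [B] at once; it is taken in the half square so that [push_homeo]
   applies. *)
have [v [v2 Gv]] : sq (1 / 2 : R) `&` \bigcap_i G i !=set0.
  apply: (Baire GP); last exact: open_sq.
  by exists 0; rewrite /sq /= normr0; lra.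
have {}v2 : `|v| <= 1 / 2 by exact: ltW.
have [g [cg pK gK]] := push_homeo v2.
have g2 p : 1 / 2 <= `|p| -> g p = p.
  by move=> p2; rewrite -{1}(push_out v p2) pK.
have p1 p : `|p| < 1 -> `|push v p| < 1.
  move=> p1; have [p2|p2] := ltP `|p| (1 / 2); last by rewrite push_out.
  by apply: lt_trans (push_sq v2 p2) _; lra.
have g1 p : `|p| < 1 -> `|g p| < 1.
  move=> p_1; rewrite ltNge; apply/negP => gp.
  have : push v (g p) = g p by apply: push_out; apply: le_trans gp; lra.
  by rewrite gK => pg; rewrite -pg leNgt p_1 in gp.
exists (disc_extend h k (push v)), (disc_extend h k g); split.
- split.
  + by apply: continuous_disc_extend => //; [exact: continuous_push|exact: push_out].
  + exact: continuous_disc_extend.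
  + move=> x; have [[p p_1 <-]|nx] := pselect ((h @` sq 1) x).
      by rewrite !disc_extendE ?pK//; exact: p1.
    by rewrite {2}/disc_extend asboolF// /disc_extend asboolF.
  + move=> x; have [[p p_1 <-]|nx] := pselect ((h @` sq 1) x).
      by rewrite !disc_extendE ?gK//; exact: g1.
    by rewrite {2}/disc_extend asboolF// /disc_extend asboolF.
- by move=> x; apply: disc_extend_out => //; exact: push_out.
- move=> b Bb Db; have [p p2 pb] := Db; have p_1 : `|p| < 1 by exact/half1/ltW.
  rewrite -pb disc_extendE// => Sp; apply: contrapT => nSp.
  have := Gv (f b) I b Bb Db erefl; apply.
  rewrite -pb (disc_chartK hk p_1) -/(push v p).
  exists (h (push v p)); last by rewrite (disc_chartK hk)// p1.
  by split => //; exists (push v p) => //; exact/ltW/push_sq.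
Qed.

(** The frontier of [S] when [S] is closed. *)
Definition bad_on S := S `&` ~` interior S.

(* Baire: a generic small push inside a disc moves the countable set off the
   nowhere dense frontier, and pushes in the discs of a finite cover compose. *)
Lemma ambient_push O B K : open O -> countable B ->
  B `<=` surface_interior R T -> compact K -> K `<=` O `&` B ->
  forall S, closed S -> exists t t', exists2 Q, compact Q /\ Q `<=` O &
    [/\ ambient_homeo t t', forall x, ~ Q x -> t x = x &
      forall b, B b -> bad_on (t @^-1` S) b -> bad_on S b /\ ~ K b].
Proof.
move=> oO cB Bint cK KOB.
have badS (t : T -> T) (S : set T) b : continuous t -> bad_on (t @^-1` S) b ->
    bad_on S (t b).
  move=> ct [Sb nSb]; split => // iSb; apply: nSb.
  by apply: ct.
(* Quantifying over [S] inside lets the second of two pushes act on the preimage of [S] under the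
   first. The clause [bad_on S b] says that no new bad point of [B] appears, so that the gain of the
   first push survives the second. *)
pose P V := forall S, closed S -> exists t t', exists2 Q, compact Q /\ Q `<=` O &
    [/\ ambient_homeo t t', forall x, ~ Q x -> t x = x &
      forall b, B b -> bad_on (t @^-1` S) b -> bad_on S b /\ ~ V b].
suff [V KV PV] : exists2 V, K `<=` V & P V.
  move=> S /PV[t [t' [Q cQ [tt Qt tS]]]]; exists t, t', Q => //; split=> //.
  by move=> b Bb /tS[]// bS nV; split => // /KV.
apply: compact_ind => //.
- move=> S cS; exists id, id, set0; first by split; [exact: compact0|].
  by split => //; split => // x; exact: cvg_id.
- move=> V W PV PW S cS; have [t [t' [Q [cQ QO] [tt Qt tS]]]] := PV _ cS.
  have ctS : closed (t @^-1` S) by have [ct _ _ _] := tt; exact: preimage_closed.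
  have [s [s' [Q' [cQ' QO'] [ss Qs sS]]]] := PW _ ctS.
  exists (t \o s), (s' \o t'), (Q `|` Q').
    by split; [exact: compactU|rewrite subUset].
  split; first exact: ambient_homeo_comp.
    move=> x nQx; rewrite /= Qs ?Qt// => Qx; apply: nQx; by [left|right].
  move=> b Bb /(sS _ Bb)[/(tS _ Bb)[bS nV] nW]; split => //.
  by move=> -[].
- move=> b Kb; have [Ob Bb] := KOB _ Kb.
  have [h [k [hk h0 DO]]] := interior_disc_chart (Bint _ Bb)
    (open_nbhs_nbhs (conj oO Ob)).
  have half1 p : `|p| <= 1 / 2 -> `|p| < 1 by move=> p2; apply: le_lt_trans p2 _; lra.
  exists (h @` sq (1 / 2)).
    apply: open_nbhs_nbhs; split.
      apply: disc_chart_open hk _ _; first exact: open_sq.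
      by move=> p p2; exact/half1/ltW.
    by exists 0 => //; rewrite /sq /= normr0; lra.
  move=> S cS; have [t [t' [tt Qt tS]]] := disc_push hk cS cB.
  exists t, t', (h @` csq (1 / 2)).
    split; first by apply: disc_chart_compact hk _ _; [exact: compact_csq|exact: half1].
    by move=> _ [p p2 <-]; apply: DO; exists p => //; exact: half1.
  split => //.
    move=> x nQx; apply: Qt => -[p p2 px]; apply: nQx; exists p => //.
    exact: ltW.
  move=> b' Bb' bb'; have [ct _ _ _] := tt; have [Sb nSb] := badS _ _ _ ct bb'.
  have nD : ~ (h @` sq (1 / 2)) b' by move=> Db; apply: nSb; exact: tS Db Sb.
  by split => //; rewrite -(Qt _ nD).
Qed.

End ambient.

(** * Local topology of surfaces *)

Section local_surface.
Context (R : realType) (T : topologicalType).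
Implicit Types (h : R * R -> T) (k : T -> R * R) (p q v : R * R).
Implicit Types (B S O V M : set T).

Definition locally_surface := forall x : T, surface_at R [set: T] x.

Lemma surface_locally_surface : surface R T -> locally_surface.
Proof.
move=> [_ _ sT] x; have [U [oU Ux] [W oW hUW]] := sT x.
have [a [b UW]] := homeomorphic_homeo_on x (0 : R * R) hUW.
by exists U, W, a, b; split => //; rewrite setTI.
Qed.

Lemma half_plane_ball (c : R * R) r : ball c r `&` half_plane R =
  `]c.1 - r, c.1 + r[%classic `*` (`]c.2 - r, c.2 + r[%classic `&` [set y | 0 <= y]).
Proof.
apply/seteqP; split=> -[x y]; rewrite /half_plane/= !in_itv/=.
  move=> [[/= cx cy] y0]; move: cx cy; rewrite -!ball_normE /ball_/=.
  by rewrite !ltr_distlC => -> ->.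
move=> [cx [cy y0]]; split => //; split => /=; rewrite -ball_normE /ball_/=.
- by rewrite ltr_distlC.
- by rewrite ltr_distlC.
Qed.

Lemma closed_half_plane : closed (half_plane R).
Proof.
apply: (@preimage_closed _ _ snd [set y : R | 0 <= y]).
  by move=> p _; exact: cvg_snd.
exact: closed_ge.
Qed.

(** Half balls are boxes, which handles interior and boundary points alike. The smaller radius [e]
    leaves room for a closed box inside the chart, as local compactness demands. *)
Lemma surface_at_half_ball x V : surface_at R [set: T] x -> nbhs x V ->
  exists c r b, [/\ 0 < r, half_plane R c,
    continuous_on (ball c r `&` half_plane R) b,
    b @` (ball c r `&` half_plane R) `<=` V &
    forall e, 0 < e -> e <= r -> open (b @` (ball c e `&` half_plane R)) /\
      (b @` (ball c e `&` half_plane R)) x].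
Proof.
move=> [U [W [a [b [oU Ux oW]]]]]; rewrite setTI => -[UW WU ca cb] xV.
have [[Wax Hax] bax] := UW _ Ux.
have aW : nbhs (a x) W by exact: open_nbhs_nbhs.
have : nbhs (b (a x)) V by rewrite bax.
move=> /(cb _ (conj Wax Hax)) /filterI /(_ aW) /nbhs_ballP[r /= r0 rO].
have rW q : ball (a x) r q -> half_plane R q -> (W `&` half_plane R) q.
  by move=> /rO[].
exists (a x), r, b; split => //.
- by apply: continuous_on_sub cb => q [rq Hq]; exact: rW.
- move=> _ [q [rq Hq] <-]; have [Vb Wq] := rO _ rq.
  by apply: Vb.
- move=> e e0 er; split; last by exists (a x) => //; split => //; exact: ballxx.
  have [W' oW' W'a] := continuous_on_open_preimage ca (ball_open (a x) e).
  rewrite (_ : b @` _ = U `&` W'); first exact: openI.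
  apply/seteqP; split=> [_ [q [eq Hq] <-]|y [Uy /(W'a _ Uy) ey]].
  + have [Ub abq] := WU _ (rW _ (le_ball er eq) Hq).
    by split => //; apply/W'a => //; rewrite abq.
  + have [[_ Hay] bay] := UW _ Uy.
    by exists (a y).
Qed.

Lemma surface_locally_connected : locally_surface -> locally_connected T.
Proof.
move=> sT x V xV.
have [c [r [b [r0 Hc cb bV bo]]]] := surface_at_half_ball (sT x) xV.
have [ob bx] := bo r r0 (lexx r).
exists (b @` (ball c r `&` half_plane R)); split => //.
apply: continuous_on_connected => //; rewrite half_plane_ball -[X in connected X]setD0.
move: Hc; rewrite /half_plane/= => c0.
apply: connected_setXD => //.
- exact: interval_is_interval.
- move=> y z [y1 y0] [z1 z0] w ywz; split.
    by apply: (@interval_is_interval _ `]c.2 - r, c.2 + r[ y z) => //.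
  by move: y0 ywz => /= y0 /andP[yw _]; exact: le_trans yw.
- by exists c.1, (c.1 + r / 2); rewrite /= !in_itv/=; split; lra.
- by exists c.2, (c.2 + r / 2); rewrite /= !in_itv/=; split; [lra|split; lra|split; lra].
Qed.

Lemma surface_locally_compact : locally_surface -> locally_compact_space T.
Proof.
move=> sT x V xV.
have [c [r [b [r0 Hc cb bV bo]]]] := surface_at_half_ball (sT x) xV.
have e0 : 0 < r / 2 by lra.
have er : r / 2 <= r by lra.
have [ob bx] := bo _ e0 er.
pose K := (`[c.1 - r / 2, c.1 + r / 2]%classic `*` `[c.2 - r / 2, c.2 + r / 2]%classic)
  `&` half_plane R.
have KB : K `<=` ball c r `&` half_plane R.
  move=> [y z] [[/= ]]; rewrite !in_itv/= => /andP[? ?] /andP[? ?] Hz; split => //.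
  split => /=; rewrite -ball_normE /ball_/= ltr_distlC; apply/andP; split; lra.
have BK : ball c (r / 2) `&` half_plane R `<=` K.
  rewrite half_plane_ball => -[y z] [/=]; rewrite !in_itv/= => /andP[? ?].
  move=> [/andP[? ?] ?]; split => //; split; rewrite /= in_itv/=; apply/andP; split; lra.
exists (b @` K); split.
- apply: continuous_on_compact; first exact: continuous_on_sub cb.
  apply: compact_closedI; last exact: closed_half_plane.
  by apply: compact_setX; exact: segment_compact.
- apply: (filterS _ (open_nbhs_nbhs (conj ob bx))).
  exact: image_subset.
- by apply: subset_trans bV; exact: image_subset.
Qed.

Lemma disc_chart_connectedD h k B : disc_chart h k -> countable B ->
  connected (h @` sq 1 `\` B) /\ (h @` sq 1 `\` B) !=set0.
Proof.
move=> hk cB.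
have cB' : countable (k @` (B `&` h @` sq 1)).
  apply: (@sub_countable _ _ _ (B `&` h @` sq 1)); first exact: card_image_le.
  by apply: sub_countable cB; exact: subset_card_le.
have -> : h @` sq 1 `\` B = h @` (sq 1 `\` k @` (B `&` h @` sq 1)).
  apply/seteqP; split=> [_ [[p p1 <-] nB]|_ [p [p1 nB] <-]].
  - exists p => //; split => // -[y [By Dy] yp]; apply: nB.
    by rewrite -yp (disc_chart_image hk Dy).2.
  - split; first by exists p.
    move=> Bp; apply: nB; exists (h p); last exact: disc_chartK hk p1.
    by split => //; exists p.
split.
- by apply: disc_chart_connected hk _ _; [exact: connected_sqD|move=> p []].
- have [r [r0 r1 nr]] := generic_radius (@ltr01 R) cB'.
  exists (h (r, 0)), (r, 0) => //.
  have rr : `|(r, 0) : R * R| = r.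
    by rewrite norm_pairE /= normr0 gtr0_norm//; apply/max_idPl; exact: ltW.
  by split; [rewrite /sq/= rr|move=> /nr; rewrite rr eqxx].
Qed.

Lemma openD_neq0 B O : countable B -> B `<=` surface_interior R T ->
  open O -> O !=set0 -> (O `\` B) !=set0.
Proof.
move=> cB Bint oO [x Ox]; have [Bx|nBx] := pselect (B x); last by exists x.
have [h [k [hk _ DO]]] := interior_disc_chart (Bint _ Bx)
  (open_nbhs_nbhs (conj oO Ox)).
have [_ [y [Dy nBy]]] := disc_chart_connectedD hk cB.
by exists y; split => //; exact: DO.
Qed.

(** A separation of [O] without [B] would extend to [O]: around each point some neighbourhood lies
    on one side up to [B], because a disc without [B] is connected. The two extended sides are
    disjoint, since no nonempty open set is contained in [B]. *)
Lemma connectedD_countable B O : countable B -> B `<=` surface_interior R T ->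
  open O -> connected O -> connected (O `\` B).
Proof.
move=> cB Bint oO /connectedE cO; apply/connectedE => V1 V2 oV1 oV2 OO OOO [x0 [[Ox0 nBx0] V1x0]].
pose E (A : set T) := [set x | exists V, [/\ open V, V x, V `<=` O & V `\` B `<=` A]].
have oE A : open (E A).
  rewrite openE => x [V [oV Vx VO VA]].
  by apply: (filterS _ (open_nbhs_nbhs (conj oV Vx))) => y Vy; exists V.
have OE : O `<=` E V1.
  apply: (cO _ _ (oE V1) (oE V2)).
  - move=> x Ox; have [Bx|nBx] := pselect (B x); last first.
      have [V1x|V2x] := OO _ (conj Ox nBx); [left|right].
        by exists (O `&` V1); split; [exact: openI|split|move=> y []|move=> y [[]]].
      by exists (O `&` V2); split; [exact: openI|split|move=> y []|move=> y [[]]].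
    have [h [k [hk h0 DO]]] := interior_disc_chart (Bint _ Bx)
      (open_nbhs_nbhs (conj oO Ox)).
    have Dx : (h @` sq 1) x by exists 0 => //; rewrite /sq/= normr0.
    have [cD [y Dy]] := disc_chart_connectedD hk cB.
    have DOO : h @` sq 1 `\` B `<=` V1 `|` V2.
      by move=> z [Dz nBz]; apply: OO; split => //; exact: DO.
    have D0 : (h @` sq 1 `\` B) `&` V1 `&` V2 = set0.
      apply/seteqP; split=> // z [[[Dz nBz] V1z] V2z]; rewrite -OOO.
      by split => //; split => //; split => //; exact: DO.
    have [V1y|V2y] := DOO _ Dy; [left|right]; exists (h @` sq 1); split => //.
    + exact: hk.1.
    + by apply: (iffLR (connectedE _) cD V1 V2) => //; exists y.
    + exact: hk.1.
    + apply: (iffLR (connectedE _) cD V2 V1) => //.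
      * by rewrite setUC.
      * by rewrite -setIA (setIC V2) setIA.
      * by exists y.
  - apply/seteqP; split => // x [[Ox [V [oV Vx VO VV1]]] [W [oW Wx WO WV2]]].
    have [||y [[Vy Wy] nBy]] := openD_neq0 cB Bint (O := V `&` W).
    + exact: openI.
    + by exists x.
    + suff : set0 y by []; rewrite -OOO; split; last exact: (WV2 _ (conj Wy nBy)).
      by split; [split; [exact: VO|exact: nBy]|exact: (VV1 _ (conj Vy nBy))].
  - exists x0; split => //; exists (O `&` V1).
    by split; [exact: openI|split|move=> y []|move=> y [[]]].
by move=> x [/OE[V [_ Vx _ VV1]] nBx]; apply: VV1.
Qed.

End local_surface.

(** * Cutting out a countable set *)

Section cut.
Context (R : realType) (T : topologicalType) (hT : hausdorff_space T).
Context (B : set T) (cB : countable B) (clB : closed B).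
Context (Bint : B `<=` surface_interior R T).
Implicit Types (h : R * R -> T) (k : T -> R * R) (p q v : R * R).
Implicit Types (S V M : set T).

Let half1 (r : R) : r < 1 -> csq r `<=` sq 1.
Proof. by move=> r1 p pr; exact: le_lt_trans pr r1. Qed.

(** The frontier of [S] misses [B], so a small disc around any point of [B] in [S] lies in [S] and
    can be cut out. *)
Definition removable S :=
  compact_subsurface R S /\ forall b, B b -> S b -> interior S b.

Lemma generic_disc_radius h k (a b : R) : a < b -> exists r, [/\ a < r, r < b &
  forall p, B (h p) -> disc_chart h k -> `|p| < 1 -> `|p| != r].
Proof.
move=> ab; have cB' : countable (k @` B) by apply: sub_countable cB; exact: card_image_le.
have [r [ar rb nr]] := generic_radius ab cB'.
exists r; split => // p Bp hk p1; apply: nr; exists (h p) => //.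
exact: disc_chartK hk p1.
Qed.

Lemma remove_disc S b : removable S -> B b -> S b ->
  exists S', [/\ removable S', S' `<=` S, S `\` S' `<=` interior S & ~ S' b].
Proof.
move=> [/(compact_subsurfaceP _ _ hT)[cS sS] SB] Bb Sb.
have [h [k [hk h0 DS]]] := interior_disc_chart (Bint Bb)
  (open_nbhs_nbhs (conj (@open_interior _ S) (SB _ Bb Sb))).
(* The radius is generic so that the new boundary square misses [B], which keeps the result
   removable. *)
have [r [r0 r1 nr]] := generic_disc_radius h k (@ltr01 R).
pose N := h @` sq r; pose Q := h @` csq r.
have rD : sq r `<=` sq 1 by move=> p pr; exact: lt_trans pr r1.
have oN : open N by exact: (disc_chart_open hk (@open_sq R r) rD).
have clQ : closed Q.
  by apply: compact_closed => //; apply: disc_chart_compact hk (@compact_csq R r) (half1 r1).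
have NE p : `|p| < 1 -> N (h p) <-> `|p| < r.
  move=> p1; split=> [[q qr qp]|pr]; last by exists p.
  by rewrite -(disc_chart_inj hk (rD _ qr) p1 qp).
have QE p : `|p| < 1 -> Q (h p) <-> `|p| <= r.
  move=> p1; split=> [[q qr qp]|pr]; last by exists p.
  by rewrite -(disc_chart_inj hk (half1 r1 qr) p1 qp).
exists (S `\` N); split.
- split.
    apply/compact_subsurfaceP => //; split.
      apply: (subclosed_compact _ cS); last by move=> x [].
      by apply: closedI; [exact: compact_closed|exact: open_closedC].
    (* Off the closed square nothing has changed; on its boundary the set looks like the outside of
       the square. *)
    move=> x [Sx nNx]; have [Qx|nQx] := pselect (Q x); last first.
      apply: (surface_at_local (closed_openC clQ) nQx _ (sS _ Sx)).
      apply/seteqP; split=> [y [Sy nQy]|y [[Sy _] nQy]] //; split => //; split => // -[q qr qy].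
      by apply: nQy; exists q => //; exact: ltW.
    have [p pr px] := Qx; have p1 : `|p| < 1 := half1 r1 pr.
    have rp : r <= `|p| by rewrite leNgt; apply/negP => pr'; apply: nNx; exists p.
    rewrite -px; apply: (disc_chart_surface_at (A := square_region r 1) (U := setT) hk) => //.
    + by apply: surface_at_square_region; rewrite ?mulr1// /square_region/= mul1r subr_ge0.
    + exact: openT.
    + by rewrite /square_region/= mul1r subr_ge0.
    + move=> q q1 _; rewrite /square_region/= mul1r subr_ge0; split.
        by move=> [_ nNq]; rewrite leNgt; apply/negP => /(NE _ q1).
      move=> rq; split; first by apply: interior_subset; apply: DS; exists q.
      by move=> /(NE _ q1); rewrite ltNge rq.
  move=> b' Bb' [Sb' nNb'].
  have nQb' : ~ Q b'.
    move=> [p pr pb]; have p1 : `|p| < 1 := half1 r1 pr.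
    have := nr p; rewrite pb => /(_ Bb' hk p1) /eqP; apply.
    apply/eqP; rewrite eq_le pr /= leNgt; apply/negP => pr'.
    by apply: nNb'; exists p.
  apply: (filterS _ (filterI (SB _ Bb' Sb') (open_nbhs_nbhs (conj (closed_openC clQ) nQb')))).
  move=> y [Sy nQy]; split => // -[q qr qy].
  by apply: nQy; exists q => //; exact: ltW.
- by move=> x [].
- move=> x [Sx nSNx]; have [[p pr <-]|nNx] := pselect (N x).
    by apply: DS; exists p => //; exact: rD.
  by case: nSNx.
- by move=> [_ nNb]; apply: nNb; exists 0 => //; rewrite /sq/= normr0.
Qed.

(* Remove successively small discs around the points of an enumeration of [B];
   by compactness of [B `&` S], finitely many removals are enough. *)
Lemma cut_countable S : removable S -> exists S', [/\ compact_subsurface R S',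
  S' `<=` S, S `\` S' `<=` interior S & S' `&` B = set0].
Proof.
move=> rS; have /countable_injP[f fI] := cB.
pose P A := [/\ removable A, A `<=` S & S `\` A `<=` interior S].
pose r (n : nat) (A A' : set T) := A' `<=` A /\ forall b, B b -> f b = n -> ~ A' b.
have [||u [u0 uP]] := @dependent_choice _ P r S.
- by split => // x [].
- move=> n A [rA AS SA].
  have [[b [Bb Ab fb]]|nob] := pselect (exists b, [/\ B b, A b & f b = n]); last first.
    exists A; split; last by [].
    by split => // b Bb fb Ab; apply: nob; exists b.
  have [A' [rA' A'A AA' nA'b]] := remove_disc rA Bb Ab.
  exists A'; split.
    split => // b' Bb' fb'; rewrite (_ : b' = b)//.
    by apply: fI; rewrite ?inE ?fb' ?fb.
  split => //; first exact: subset_trans AS.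
  move=> x [Sx nA'x]; have [Ax|nAx] := pselect (A x); last exact: SA.
  by apply: (filterS AS); exact: (AA' _ (conj Ax nA'x)).
have um n m : (n <= m)%N -> u m `<=` u n.
  elim: m => [|m IH]; first by rewrite leqn0 => /eqP ->.
  rewrite leq_eqVlt => /predU1P[->//|/IH]; apply: subset_trans.
  by have [_ []] := uP m.
have cu n : closed (u n).
  have [[[/(compact_subsurfaceP _ _ hT)[cun _] _] _ _] _] := uP n.
  exact: compact_closed.
have cBS : compact (B `&` S).
  rewrite setIC; apply: compact_closedI => //.
  by have [/(compact_subsurfaceP _ _ hT)[]] := rS.
have /compact_near_coveringP/(_ _ \oo (fun n x => ~ u n x)) := cBS.
case.
(* The point [b] disappears at step [f b], hence from [u (f b).+1]; that set is closed, so a whole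
   neighbourhood of [b] has gone from then on. *)
- move=> b [Bb Sb]; have nub : ~ u (f b).+1 b by have [_ [_ +]] := uP (f b); exact.
  exists (~` u (f b).+1, [set n | ((f b).+1 <= n)%N]).
    split; last by exists (f b).+1.
    exact: open_nbhs_nbhs (conj (closed_openC (cu _)) nub).
  by move=> [x n] [/= nux fn] /(um _ _ fn).
move=> n _ /(_ n (leqnn n)) un; exists (u n).
have [[[sun _] unS Sun] _] := uP n; split => //.
apply/seteqP; split => // x [ux Bx].
exact: (un x (conj Bx (unS _ ux)) ux).
Qed.

(** The inside of a small square is separated from the rest by an annulus around it. Both radii are
    generic, on either side of 1/2, so the two boundary squares miss [B]. *)
Lemma annulus_removable b V : B b -> nbhs b V -> locally_connected T ->
  exists S M, [/\ removable S, is_component (~` S) M, nbhs b M & M `<=` V].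
Proof.
move=> Bb bV lcT; have [h [k [hk h0 DV]]] := interior_disc_chart (Bint Bb) bV.
have [r [r0 rh nr]] : exists r, [/\ 0 < r, r < 1 / 2 &
  forall p, B (h p) -> disc_chart h k -> `|p| < 1 -> `|p| != r].
  by apply: generic_disc_radius; lra.
have [s [hs s1 ns]] : exists r, [/\ 1 / 2 < r, r < 1 &
  forall p, B (h p) -> disc_chart h k -> `|p| < 1 -> `|p| != r].
  by apply: generic_disc_radius; lra.
have rs : r < s by lra.
have r1 : r < 1 by lra.
pose A := [set p : R * R | r <= `|p| /\ `|p| <= s].
have A1 : A `<=` sq 1 by move=> p [_]; exact: half1.
have oC (e : R) : open [set p : R * R | e < `|p|].
  rewrite (_ : mkset _ = (Num.norm : R * R -> R) @^-1` [set x | e < x])//.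
  by apply: open_comp; [move=> p _; exact: norm_continuous|exact: open_gt].
have cA : compact A.
  apply: (subclosed_compact _ (@compact_csq R s)); last by move=> p [].
  rewrite (_ : A = ~` [set p : R * R | `|p| < r] `&` ~` [set p | s < `|p|]).
    by apply: closedI; apply: open_closedC; [exact: open_sq|exact: oC].
  apply/seteqP; split=> p; rewrite /A/= ?leNgt.
    by move=> [/negP ? /negP ?].
  by move=> [/negP ? /negP ?].
have AE p : `|p| < 1 -> (h @` A) (h p) <-> A p.
  move=> p1; split=> [[q Aq qp]|Ap]; last by exists p.
  by rewrite -(disc_chart_inj hk (A1 _ Aq) p1 qp).
pose S := h @` A; pose M := h @` sq r.
have rD : sq r `<=` sq 1 by move=> p pr; exact: lt_trans pr r1.
have oM : open M by apply: disc_chart_open hk (@open_sq R r) rD.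
have sS : compact_subsurface R S.
  apply/compact_subsurfaceP => //; split; first exact: disc_chart_compact hk cA A1.
  move=> _ [p Ap <-]; have [rp ps] := Ap; have p1 := A1 _ Ap.
  (* Within radius [s] only the inner boundary square matters, and beyond radius [r] only the outer
     one. *)
  have [ps'|ps'] := ltP `|p| s.
    have sD : sq s `<=` sq 1 by move=> q qs; exact: lt_trans qs s1.
    apply: (disc_chart_surface_at (A := square_region r 1) (U := h @` sq s) hk) => //.
    + by apply: surface_at_square_region; rewrite ?mulr1// /square_region/= mul1r subr_ge0.
    + exact: disc_chart_open hk (@open_sq R s) sD.
    + by rewrite /square_region/= mul1r subr_ge0.
    + move=> q q1 [q' qs' qq]; rewrite -qq.
      have -> : q = q' by exact/esym/(disc_chart_inj hk (sD _ qs') q1 qq).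
      have AEq := AE _ (sD _ qs'); rewrite /square_region/= mul1r subr_ge0.
      by split => [/AEq[]//|rq]; apply/AEq; split => //; exact: ltW.
  have UD : [set q : R * R | r < `|q|] `&` sq 1 `<=` sq 1 by move=> q [].
  apply: (disc_chart_surface_at (A := square_region s (-1))
    (U := h @` ([set q : R * R | r < `|q|] `&` sq 1)) hk) => //.
  + apply: surface_at_square_region; rewrite ?mulrNN ?mulr1//; first lra.
    by rewrite /square_region/=; lra.
  + by apply: disc_chart_open hk _ UD; apply: openI => //; exact: open_sq.
  + by exists p => //; split => //=; exact: lt_le_trans ps'.
  + by rewrite /square_region/=; lra.
  + move=> q q1 [q' [rq' q1'] qq]; rewrite -qq.
    have -> : q = q' by exact/esym/(disc_chart_inj hk q1' q1 qq).
    have AEq := AE _ q1'; rewrite /square_region/=.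
    split => [/AEq[? ?]|?]; first lra.
    by apply/AEq; split; [exact: ltW|lra].
exists S, M; split.
- split => // b' Bb' [p Ap pb]; have [rp ps] := Ap; have p1 := A1 _ Ap.
  have Bp : B (h p) by rewrite pb.
  have pr : r < `|p| by rewrite lt_neqAle eq_sym nr.
  have ps' : `|p| < s by rewrite lt_neqAle ns.
  have ob : open (h @` ([set q : R * R | r < `|q|] `&` sq s)).
    apply: disc_chart_open hk _ _; first by apply: openI => //; exact: open_sq.
    by move=> q [_ qs]; exact: lt_trans qs s1.
  rewrite -pb; have pO : (h @` ([set q : R * R | r < `|q|] `&` sq s)) (h p) by exists p.
  apply: (filterS _ (open_nbhs_nbhs (conj ob pO))).
  by move=> _ [q [rq qs] <-]; exists q => //; split; exact: ltW.
- apply: clopen_is_component => //.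
  + by exists (h 0), 0 => //; rewrite /sq/= normr0.
  + move=> _ [p pr <-] /(AE _ (rD _ pr)) [rp _].
    by move: pr; rewrite /sq/= ltNge rp.
  + apply: disc_chart_connected hk _ rD; rewrite -[sq r]setD0.
    exact: connected_sqD.
  + move=> x [clx nSx].
    have : closed (h @` csq r).
      by apply: compact_closed => //; apply: disc_chart_compact hk (@compact_csq R r) (half1 r1).
    move=> /closure_id QE.
    have [p pr px] : (h @` csq r) x.
      rewrite QE; apply: closureS clx => _ [p pr <-]; exists p => //; exact: ltW.
    exists p => //; rewrite /sq/= ltNge; apply/negP => rp; apply: nSx.
    by exists p => //; split => //; apply: le_trans pr _; exact: ltW.
- apply: open_nbhs_nbhs; split => //; rewrite -h0; exists 0 => //.
  by rewrite /sq/= normr0.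
- by move=> _ [p pr <-]; apply: DV; exists p => //; exact: rD.
Qed.

End cut.

(** The complement grows only by points interior to [S]. Such points are not adherent to [M], which
    therefore remains closed in the larger complement. *)
Lemma is_component_cut (T : topologicalType) (S S' M : set T) :
  locally_connected T -> closed S -> S' `<=` S -> S `\` S' `<=` interior S ->
  is_component (~` S) M -> is_component (~` S') M.
Proof.
move=> lcT cS S'S SS' MS.
have oM := is_component_open lcT (closed_openC cS) MS.
apply: clopen_is_component => //.
- exact: is_component_neq0 MS.
- by apply: subset_trans (is_component_sub MS) _; exact: subsetC.
- exact: is_component_connected MS.
- move=> x [clx nS'x]; have [Sx|nSx] := pselect (S x); last first.
    by apply: (is_component_closure lcT (closed_openC cS) MS).
  have [y [My Sy]] := clx _ (SS' _ (conj Sx nS'x)).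
  by case: (is_component_sub MS My).
Qed.

(** * The topology of the end compactification *)

(** The continuity conditions range over all related pairs, so they also give uniqueness: two
    partners of a point lie in each other's neighbourhoods and coincide by separation. *)
Lemma relation_homeo (X Y : topologicalType) (r : X -> Y -> Prop) :
  hausdorff_space X -> hausdorff_space Y ->
  (forall x, exists y, r x y) -> (forall y, exists x, r x y) ->
  (forall x y V, r x y -> open V -> V y -> exists2 U, open U /\ U x &
     forall x' y', U x' -> r x' y' -> V y') ->
  (forall x y U, r x y -> open U -> U x -> exists2 V, open V /\ V y &
     forall x' y', V y' -> r x' y' -> U x') ->
  exists2 F : X -> Y, homeomorphism F & forall x y, r x y -> F x = y.
Proof.
move=> hX hY /choice[F rF] /choice[G rG] cr cr'.
have rfun x y y' : r x y -> r x y' -> y = y'.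
  move=> xy xy'; apply: hY => V W yV y'W.
  have [U [oU Ux] UV] := cr _ _ _ xy (open_interior V) yV.
  exists y'; split; last exact: nbhs_singleton.
  by apply: interior_subset; exact: UV xy'.
have rinj x x' y : r x y -> r x' y -> x = x'.
  move=> xy x'y; apply: hX => V W xV x'W.
  have [U [oU Ux] UV] := cr' _ _ _ xy (open_interior V) xV.
  exists x'; split; last exact: nbhs_singleton.
  by apply: interior_subset; exact: UV x'y.
exists F; last by move=> x y; exact: rfun (rF x).
split.
  apply/continuousP => V oV; rewrite openE => x Vx.
  have [U [oU Ux] UV] := cr _ _ _ (rF x) oV Vx.
  apply: (filterS _ (open_nbhs_nbhs (conj oU Ux))) => x' Ux'.
  exact: UV (rF x').
exists G; split.
- apply/continuousP => V oV; rewrite openE => y Vy.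
  have [U [oU Uy] UV] := cr' _ _ _ (rG y) oV Vy.
  apply: (filterS _ (open_nbhs_nbhs (conj oU Uy))) => y' Uy'.
  exact: UV (rG y').
- by move=> x; apply: rinj (rF x); exact: rG.
- by move=> y; apply: rfun (rG y); exact: rF.
Qed.

Section end_compactification.
Context (R : realType) (T : topologicalType).
Context (hT : hausdorff_space T) (lcT : locally_connected T).
Context (lkT : locally_compact_space T).
Implicit Types (M N : end_rep R T) (e : end_space R T).
Implicit Types (z w : end_compactification R T) (P Q S V : set T).

(** The trace on [T] of the neighbourhood filter of [z], which puts points and ends on the same
    footing. *)
Definition end_nbhs z Q : Prop :=
  match z with inl x => nbhs x Q | inr e => end_in e Q end.

Lemma end_nbhsS z P Q : P `<=` Q -> end_nbhs z P -> end_nbhs z Q.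
Proof.
case: z => [x PQ xP|e PQ eP M Me]; first exact: (@filterS _ (nbhs x) _ _ _ PQ xP).
by have [n nP] := eP M Me; exists n; exact: subset_trans PQ.
Qed.

Lemma end_nbhs_hat z Q : end_nbhs z Q -> end_hat Q z.
Proof. by case: z => //= x; exact: nbhs_singleton. Qed.

Lemma end_hat_nbhs z Q : open Q -> end_hat Q z -> end_nbhs z Q.
Proof. by case: z => //= x oQ Qx; exact: open_nbhs_nbhs. Qed.

Lemma open_end_hat_open Q : open Q -> open (@end_hat R T Q).
Proof.
move=> oQ; split=> // e eQ; have [M Me] := end_repP e.
have [n nQ] := eQ M Me; exists (val M n); first exact: end_base_rep.
exact: end_hatS.
Qed.

Lemma end_rep_component M n : exists2 S, compact_subsurface R S &
  is_component (~` S) (val M n).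
Proof. by have [_ + _] := set_valP M; exact. Qed.

Lemma end_rep_open M n : open (val M n).
Proof.
have [S [cS _] MS] := end_rep_component M n.
by apply: is_component_open MS => //; apply: closed_openC; exact: compact_closed.
Qed.

Lemma end_rep_neq0 M n : val M n !=set0.
Proof. by have [S _ /is_component_neq0] := end_rep_component M n. Qed.

Lemma end_rep_escape M (C : set T) : compact C ->
  exists k, forall n, (k <= n)%N -> C `&` val M n = set0.
Proof. by move=> cC; have [_ _ /(_ C cC)[k _ kC]] := set_valP M; exists k. Qed.

Lemma end_in_compact e (C : set T) : compact C -> ~ end_in e C.
Proof.
move=> cC; have [M Me] := end_repP e => /(_ M Me)[n nC].
have [k kC] := end_rep_escape M cC.
have [x Mx] := end_rep_neq0 M (maxn n k).
have : (C `&` val M (maxn n k)) x.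
  by split => //; apply: nC; apply: end_rep_decr Mx; exact: leq_maxl.
by rewrite kC// leq_maxr.
Qed.

(** Each point of the compact [S] bounding [val M n] has a compact neighbourhood that the sequence
    leaves, so some closure misses [S]. Being connected, it stays in one component. *)
Lemma end_rep_closure M n : exists m, closure (val M m) `<=` val M n.
Proof.
have [S [cS _] MS] := end_rep_component M n.
have /compact_near_coveringP/(_ _ \oo (fun m x => ~ closure (val M m) x)) := cS.
case.
  move=> x _; have [K [cK xK _]] := lkT (@filterT _ (nbhs x) _).
  have [k kK] := end_rep_escape M cK.
  exists (interior K, [set m | (k <= m)%N]).
    by split; [exact: open_nbhs_nbhs (conj (@open_interior _ K) xK)|exists k].
  move=> [y m] [/= Ky km] /(_ _ Ky)[v [Mv Kv]].
  have : (K `&` val M m) v by [].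
  by rewrite kK.
move=> k _ kS; exists (maxn n k).
have [x Mx] := end_rep_neq0 M (maxn n k).
apply: (is_component_max MS).
- apply: connected_closure; have [S' _] := end_rep_component M (maxn n k).
  exact: is_component_connected.
- by move=> y cly Sy; apply: (kS _ (leq_maxr n k)) cly.
- exists x; split; first exact: subset_closure.
  by apply: end_rep_decr Mx; exact: leq_maxl.
Qed.

(** Regularity, with the closure taken in [T] only. It absorbs the closure lost when neighbourhoods
    are compared up to [B]. *)
Lemma end_compactification_regular z (V : set (end_compactification R T)) :
  open V -> V z -> exists Q, [/\ open Q, end_nbhs z Q &
    end_hat (closure Q) `<=` V].
Proof.
move=> [oV eV]; case: z => [x Vx|e /eV[P [_ eP] PV]].
  have [K [cK xK KV]] := lkT (open_nbhs_nbhs (conj oV (Vx : (inl @^-1` V) x))).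
  exists (interior K); split; first exact: open_interior.
    exact: open_nbhs_nbhs (conj (@open_interior _ K) xK).
  have clK : closure (interior K) `<=` K.
    move=> y cly; apply: (compact_closed hT cK); apply: closureS cly.
    exact: interior_subset.
  move=> [y /clK/KV//|e]; move=> /(end_hatS clK) eK.
  by case: (end_in_compact (e := e) cK).
have [M Me] := end_repP e; have [n nP] := eP M Me.
have [m mn] := end_rep_closure M n.
exists (val M m); split; first exact: end_rep_open.
  by move=> N Ne; exact: same_endP Me Ne m.
by apply: subset_trans PV; apply: end_hatS; exact: subset_trans nP.
Qed.

Lemma end_hat_disjoint P Q : P `&` Q = set0 ->
  @end_hat R T P `&` @end_hat R T Q = set0.
Proof.
move=> PQ; apply/seteqP; split => // -[x [Px Qx]|e [eP eQ]].
  by have : (P `&` Q) x by []; rewrite PQ.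
have [M Me] := end_repP e; have [n nP] := eP M Me; have [m mQ] := eQ M Me.
have [x Mx] := end_rep_neq0 M (maxn n m).
have : (P `&` Q) x; last by rewrite PQ.
split; [apply: nP|apply: mQ]; apply: end_rep_decr Mx.
- exact: leq_maxl.
- exact: leq_maxr.
Qed.

Lemma end_nbhs_separated z w : z <> w ->
  exists P Q, [/\ open P, open Q, end_nbhs z P, end_nbhs w Q & P `&` Q = set0].
Proof.
have inlr x e : exists P Q, [/\ open P, open Q, end_nbhs (inl x) P,
    end_nbhs (inr e) Q & P `&` Q = set0].
  have [K [cK xK _]] := lkT (@filterT _ (nbhs x) _).
  have [M Me] := end_repP e; have [k kK] := end_rep_escape M cK.
  exists (interior K), (val M k); split.
  - exact: open_interior.
  - exact: end_rep_open.
  - exact: open_nbhs_nbhs (conj (@open_interior _ K) xK).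
  - by move=> N Ne; exact: same_endP Me Ne k.
  - apply/seteqP; split => // y [/interior_subset Ky My].
    by rewrite -(kK k (leqnn k)).
case: z w => [x|e] [y|f] zw.
- have xy : x != y by apply/eqP => xy; apply: zw; rewrite xy.
  have := hT; rewrite open_hausdorff => /(_ _ _ xy)[[A B] /= [xA yB] [oA oB AB]].
  exists A, B; split => //.
  + by apply: open_nbhs_nbhs; split => //; exact: set_mem.
  + by apply: open_nbhs_nbhs; split => //; exact: set_mem.
  + exact/eqP.
- exact: inlr.
- by have [P [Q [oP oQ yP eQ PQ]]] := inlr y e; exists Q, P; rewrite setIC.
- have [M Me] := end_repP e; have [N Nf] := end_repP f.
  have nMN : ~ same_end M N.
    move=> MN; apply: zw; congr inr; rewrite -Me -Nf /represents.
    by apply/eqmodP.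
  (* Inequivalence means that one of the two sequences has a member containing no member of the
     other. *)
  wlog [m mN] : M N e f {zw} Me Nf nMN / exists m, forall n, ~ val N n `<=` val M m.
    move=> H; have [|nm] := pselect (exists m, forall n, ~ val N n `<=` val M m).
      exact: H Me Nf nMN.
    have [|nn] := pselect (exists n, forall m, ~ val M m `<=` val N n).
      move=> /(H N M f e Nf Me); case.
        by rewrite same_end_sym.
      by move=> P [Q [oP oQ fP eQ PQ]]; exists Q, P; rewrite setIC.
    case: nMN; apply/asboolP; split => k; apply: contrapT => nk.
    - by apply: nm; exists k => n kn; apply: nk; exists n.
    - by apply: nn; exists k => n kn; apply: nk; exists n.
  have [S [cS _] MS] := end_rep_component M m.
  have [k kS] := end_rep_escape N cS.
  (* Since [val N k] is connected and misses the subsurface bounding [val M m], it is contained in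
     [val M m] or disjoint from it. *)
  exists (val M m), (val N k); split; try exact: end_rep_open.
  + by move=> M' M'e; exact: same_endP Me M'e m.
  + by move=> M' M'e; exact: same_endP Nf M'e k.
  apply: contrapT => /eqP/set0P MN0; apply: (mN k).
  have [S' _ NS'] := end_rep_component N k.
  apply: (is_component_max MS (is_component_connected NS')).
    move=> x Nx Sx; have : (S `&` val N k) x by [].
    by rewrite kS.
  by rewrite setIC.
Qed.

Lemma end_compactification_hausdorff :
  hausdorff_space (end_compactification R T).
Proof.
move=> z w zw; apply: contrapT => /end_nbhs_separated[P [Q [oP oQ zP wQ PQ]]].
have [||v] := zw (end_hat P) (end_hat Q).
- apply: open_nbhs_nbhs; split; first exact: open_end_hat_open.
  exact: end_nbhs_hat.
- apply: open_nbhs_nbhs; split; first exact: open_end_hat_open.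
  exact: end_nbhs_hat.
- by rewrite end_hat_disjoint.
Qed.

End end_compactification.

(** * Filling in a closed countable set *)

Lemma is_component_homeo (T : topologicalType) (t t' : T -> T) (A M : set T) :
  ambient_homeo t t' -> is_component A M ->
  is_component (t @^-1` A) (t @^-1` M).
Proof.
move=> [ct ct' tK tK'] AM; apply: is_component_maxP.
- have [x Mx] := is_component_neq0 AM; exists (t' x).
  by rewrite /preimage/= tK'.
- by move=> x; exact: is_component_sub AM _.
- have -> : t @^-1` M = t' @` M.
    apply/seteqP; split=> [x Mx|_ [y My <-]]; first by exists (t x).
    by rewrite /preimage/= tK'.
  apply: continuous_on_connected; first exact: continuous_continuous_on.
  exact: is_component_connected AM.
- move=> C cC CA [x [Cx Mx]] y Cy.
  have ctC : connected (t @` C).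
    by apply: continuous_on_connected cC; exact: continuous_continuous_on.
  apply: (is_component_max AM ctC).
  + by move=> _ [v Cv <-]; exact: CA.
  + by exists (t x); split => //; exists x.
  + by exists y.
Qed.

Section open_embedding.
Context (R : realType) (Om T : topologicalType) (j : Om -> T).
Context (hT : hausdorff_space T) (sT : locally_surface R T).
Context (cj : continuous j) (injj : injective j).
Context (oj : forall V : set Om, open V -> open (j @` V)).

Let B := ~` range j.
Context (cB : countable B) (Bint : B `<=` surface_interior R T).

Let lcT : locally_connected T. Proof. exact: surface_locally_connected sT. Qed.
Let lkT : locally_compact_space T. Proof. exact: surface_locally_compact sT. Qed.
Let clB : closed B. Proof. by apply: open_closedC; apply: oj; exact: openT. Qed.

Lemma embedding_inverse (x0 : Om) : exists g, cancel j g /\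
  continuous_on (range j) g.
Proof.
have /choice[g gE] : forall y, exists x, range j y -> j x = y.
  move=> y; have [[x _ xy]|ny] := pselect (range j y); first by exists x.
  by exists x0 => /ny.
have gK : cancel j g by move=> x; apply: injj; apply: gE; exists x.
exists g; split => // _ [x _ <-] V; rewrite gK => xV.
have jV : open (j @` interior V) by apply: oj; exact: open_interior.
have jx : (j @` interior V) (j x) by exists x.
apply: (filterS _ (open_nbhs_nbhs (conj jV jx))) => _ [v iV <-] _.
by rewrite gK; exact: nbhs_singleton.
Qed.

Lemma embedding_hausdorff : hausdorff_space Om.
Proof.
move=> x y xy; apply: injj; apply: hT => A C xA yC.
have [v [Av Cv]] : j @^-1` A `&` j @^-1` C !=set0 by apply: xy; exact: cj.
by exists (j v).
Qed.

Let hOm := embedding_hausdorff.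

Lemma embedding_locally_surface : locally_surface R Om.
Proof.
move=> x; have [g [gK cg]] := embedding_inverse x.
apply: (@surface_at_homeo _ _ _ (range j) _ g j) => //.
  split => //.
  - by move=> _ [v _ <-]; rewrite gK.
  - exact: continuous_continuous_on.
apply: (@surface_at_local _ _ setT _ (range j)) => //.
- by apply: oj; exact: openT.
- by rewrite setIid setTI.
Qed.

Let lcOm : locally_connected Om.
Proof. exact: surface_locally_connected embedding_locally_surface. Qed.
Let lkOm : locally_compact_space Om.
Proof. exact: surface_locally_compact embedding_locally_surface. Qed.

Lemma embedding_subsurface_image (S : set Om) (x0 : Om) :
  compact_subsurface R S -> compact_subsurface R (j @` S).
Proof.
have [g [gK cg]] := embedding_inverse x0.
apply: (@compact_subsurface_homeo _ _ _ _ _ j g) => //; split.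
- by move=> x Sx; split => //; exists x.
- by move=> _ [x Sx <-]; rewrite gK.
- exact: continuous_continuous_on.
- by apply: continuous_on_sub cg => _ [x _ <-]; exists x.
Qed.

Lemma embedding_subsurface_preimage (S : set T) (x0 : Om) : S `&` B = set0 ->
  compact_subsurface R S -> compact_subsurface R (j @^-1` S).
Proof.
move=> SB; have [g [gK cg]] := embedding_inverse x0.
have Sj : S `<=` range j.
  by move=> y Sy; apply: contrapT => By; have : (S `&` B) y by []; rewrite SB.
apply: (@compact_subsurface_homeo _ _ _ _ _ g j) => //; split.
- by move=> y /[dup] Sy /Sj[x _ xy]; rewrite -xy gK/preimage/= xy.
- by move=> x Sx; rewrite gK.
- exact: continuous_on_sub cg.
- exact: continuous_continuous_on.
Qed.

Lemma embedding_connected_preimage (C : set T) : connected C ->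
  C `<=` range j -> connected (j @^-1` C).
Proof.
apply: connected_preimage => V oV; exists (j @` V); first exact: oj.
apply/seteqP; split=> x; first by move=> Vx; exists x.
by move=> [y Vy /injj <-].
Qed.

Lemma closure_nbhsU (Q : set T) y : nbhs y (Q `|` B) -> closure Q y.
Proof.
move=> yQ V yV; have [||v [[Qv Vv] nBv]] := @openD_neq0 R T B
  (interior (Q `|` B) `&` interior V) cB Bint.
- by apply: openI; exact: open_interior.
- by exists y.
- exists v; split; last exact: interior_subset.
  by have [] := interior_subset Qv.
Qed.

(** Equality of the two neighbourhood filters as seen from [Om]. The union with [B] is forced
    because subsets of [Om] cannot control the points of [B]. *)
Definition same_trace (z : end_compactification R Om)
    (w : end_compactification R T) :=
  forall Q : set Om, end_nbhs z Q <-> end_nbhs w (j @` Q `|` B).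

Lemma same_trace_inl x : same_trace (inl x) (inl (j x)).
Proof.
move=> Q; split=> /= [xQ|jxQ].
  have oQ : open (j @` interior Q) by apply: oj; exact: open_interior.
  have jx : (j @` interior Q) (j x) by exists x.
  apply: (filterS _ (open_nbhs_nbhs (conj oQ jx))) => _ [v /interior_subset Qv <-].
  by left; exists v.
have : nbhs x (j @^-1` (j @` Q `|` B)) by exact: cj.
by apply: filterS => v [[u Qu /injj <-]//|]; case; exists v.
Qed.

(** A neighbourhood of [w'] is known only up to [B]. As [B] has dense complement, it still lies in
    the closure of [Q], and regularity concludes. *)
Lemma same_trace_cont z w (V : set (end_compactification R T)) :
  same_trace z w -> open V -> V w ->
  exists2 U, open U /\ U z & forall z' w', U z' -> same_trace z' w' -> V w'.
Proof.
move=> zw oV Vw.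
have [Q [oQ wQ QV]] := end_compactification_regular hT lcT lkT oV Vw.
have oQ' : open (j @^-1` Q) by apply: open_comp => // x _; exact: cj.
have QjQ : Q `<=` j @` (j @^-1` Q) `|` B.
  move=> y Qy; have [[x _ xy]|ny] := pselect (range j y); last by right.
  by left; exists x => //; rewrite /preimage/= xy.
exists (end_hat (j @^-1` Q)).
  split; first exact: open_end_hat_open.
  by apply: end_nbhs_hat; apply/zw; exact: end_nbhsS wQ.
move=> z' w' /(end_hat_nbhs oQ')/[swap] zw' /zw' w'Q; apply: QV.
have jjQ : j @` (j @^-1` Q) `<=` Q by move=> _ [x Qx <-].
case: w' w'Q {zw'} => [y yQ|e eQ].
  by apply: closureS (closure_nbhsU yQ).
move=> M Me; have [n nQ] := eQ M Me; exists n => y My.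
apply: closureS jjQ _ _; apply: closure_nbhsU.
apply: (filterS nQ); apply: open_nbhs_nbhs; split => //.
exact: end_rep_open.
Qed.

Lemma same_trace_cont' z w (V : set (end_compactification R Om)) :
  same_trace z w -> open V -> V z ->
  exists2 U, open U /\ U w & forall z' w', U w' -> same_trace z' w' -> V z'.
Proof.
move=> zw oV Vz.
have [Q [oQ zQ QV]] := end_compactification_regular hOm lcOm lkOm oV Vz.
pose P := interior (j @` Q `|` B).
exists (end_hat P).
  split; first by apply: open_end_hat_open; exact: open_interior.
  apply: end_nbhs_hat; move/zw : zQ; case: (w) => [y|e eQ M Me].
    by move=> /= yQ; exact: nbhs_interior.
  have [n nQ] := eQ M Me; exists n => y My.
  apply: (filterS nQ); apply: open_nbhs_nbhs; split => //.
  exact: end_rep_open.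
move=> z' w' /(end_hat_nbhs (@open_interior _ _)) wP zw'; apply: QV.
apply: (end_hatS (@subset_closure _ Q)); apply: end_nbhs_hat; apply/zw'.
by apply: end_nbhsS wP; exact: interior_subset.
Qed.

(** The component around the image of [M] remains connected without [B], so its part in [Om] cannot
    exceed [M]. *)
Lemma component_image (S M : set Om) : compact_subsurface R S ->
  is_component (~` S) M -> exists M' S', [/\ compact_subsurface R S',
    S' `&` B = set0, is_component (~` S') M' & M' `\` B = j @` M].
Proof.
move=> sS SM; have [x0 Mx0] := is_component_neq0 SM.
have sjS := embedding_subsurface_image x0 sS.
have njS x : ~ S x -> ~ (j @` S) (j x) by move=> nSx [v Sv /injj vx]; rewrite -vx in nSx.
have jx0 := njS _ (is_component_sub SM Mx0).
have oS : open (~` (j @` S)).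
  by apply: closed_openC; apply: compact_closed => //; case: sjS.
pose M' := connected_component (~` (j @` S)) (j x0).
have cM' : is_component (~` (j @` S)) M' by exists (j x0).
have M'x0 : M' (j x0) by exact: connected_component_refl.
exists M', (j @` S); split => //.
  by apply/seteqP; split => // _ [[x Sx <-]]; apply; exists x.
have jM : j @` M `<=` M'.
  apply: (is_component_max cM').
  - apply: continuous_on_connected (is_component_connected SM).
    exact: continuous_continuous_on.
  - by move=> _ [x Mx <-]; apply: njS; exact: is_component_sub SM _ Mx.
  - by exists (j x0); split => //; exists x0.
have BN : M' `\` B `<=` range j by move=> y [_ nBy]; exact: contrapT.
apply/seteqP; split; last first.
  by move=> _ [x Mx <-]; split; [apply: jM; exists x|apply; exists x].
move=> y /[dup] M'y /BN[x _ xy]; rewrite -xy; exists x => //.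
have jM' : connected (j @^-1` (M' `\` B)).
  apply: embedding_connected_preimage => //; apply: (connectedD_countable cB Bint).
    exact: is_component_open cM'.
  exact: is_component_connected cM'.
apply: (is_component_max SM jM').
- move=> v [M'v _] Sv; apply: (is_component_sub cM' M'v).
  by exists v.
- by exists x0; split => //; split => //; apply; exists x0.
- by rewrite /preimage/= xy.
Qed.

(* If the components do not leave all compact sets, they shrink to a cluster
   point, which lies in [B]: a generic small square around it has a compact
   boundary missing [B]. *)
Lemma same_trace_total z : exists w, same_trace z w.
Proof.
case: z => [x|e]; first by exists (inl (j x)); exact: same_trace_inl.
have [M Me] := end_repP e.
have /choice[M' M'P] : forall n, exists M', exists S', [/\ compact_subsurface R S',
    S' `&` B = set0, is_component (~` S') M' & M' `\` B = j @` val M n].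
  by move=> n; have [S sS SM] := end_rep_component M n; exact: component_image sS SM.
have M'M n : M' n `\` B = j @` val M n by have [S []] := M'P n.
have jM n : j @` val M n `<=` M' n by rewrite -M'M => y [].
have oM' n : open (M' n).
  have [S [[cS _] _ SM' _]] := M'P n.
  by apply: is_component_open SM' => //; apply: closed_openC; exact: compact_closed.
have cM' n : connected (M' n) by have [S [_ _ /is_component_connected]] := M'P n.
have decM' n : M' n.+1 `<=` M' n.
  have [S [_ SB SM' _]] := M'P n; apply: (is_component_max SM' (cM' _)).
    move=> y M'y Sy; have nBy : ~ B y.
      by move=> By; have : (S `&` B) y by []; rewrite SB.
    have : (j @` val M n.+1) y by rewrite -M'M.
    move=> [x Mx xy]; apply: (is_component_sub SM' _ Sy); apply: jM; exists x => //.
    exact: end_rep_decr Mx.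
  have [x Mx] := end_rep_neq0 M n.+1.
  exists (j x); split; first by apply: jM; exists x.
  by apply: jM; exists x => //; exact: end_rep_decr Mx.
have leM' n m : (n <= m)%N -> M' m `<=` M' n.
  elim: m => [|m IH]; first by rewrite leqn0 => /eqP ->.
  by rewrite leq_eqVlt => /predU1P[->//|/IH]; exact: subset_trans.
have zQ Q : end_nbhs (inr e) Q <-> exists n, M' n `<=` j @` Q `|` B.
  split=> [/(_ M Me)[n nQ]|[n nQ]]; last first.
    apply/(end_inP _ Me); exists n => x Mx.
    have : M' n (j x) by apply: jM; exists x.
    by move=> /nQ[[v Qv /injj <-]//|]; case; exists x.
  exists n => y M'y; have [By|nBy] := pselect (B y); [by right|left].
  have : (j @` val M n) y by rewrite -M'M.
  by move=> [x Mx xy]; exists x => //; exact: nQ.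
have [M'end|] := pselect (end_sequence R T M').
  pose N : end_rep R T := SigSub (mem_set M'end).
  have [f Nf] : exists f, represents N f by eexists.
  exists (inr f) => Q; apply: (iff_trans (zQ Q)).
  by split=> [nQ|/(_ N Nf)//]; exact/(end_inP _ Nf).
move=> nM'end.
(* Of the conditions on an end sequence, only escape from compact sets can fail. *)
have [C [cC CM']] : exists C : set T, compact C /\ forall n, C `&` M' n !=set0.
  apply: contrapT => nC; apply: nM'end; split => //.
    by move=> n; have [S [sS _ SM' _]] := M'P n; exists S.
  move=> C cC; apply: contrapT => CM'; apply: nC; exists C; split => // n.
  apply: contrapT => CM'n; apply: CM'; exists n => // m /= nm.
  apply: contrapT => /eqP/set0P[x [Cx M'x]]; apply: CM'n; exists x; split => //.
  exact: leM' M'x.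
have [b [Cb clb]] : exists b, C b /\ forall n, closure (M' n) b.
  apply: contrapT => nb.
  move/compact_near_coveringP : cC => /(_ _ \oo (fun n x => ~ M' n x)) [].
    move=> x Cx; have [n nx] : exists n, ~ closure (M' n) x.
      by apply: contrapT => nn; apply: nb; exists x; split => // n; apply: contrapT => ?; apply: nn; exists n.
    exists (~` closure (M' n), [set m | (n <= m)%N]).
      split; last by exists n.
      by apply: open_nbhs_nbhs; split => //; exact/closed_openC/closed_closure.
    by move=> [y m] /= [ny nm] M'y; apply: ny; apply: subset_closure; exact: leM' M'y.
  by move=> n _ /(_ n (leqnn n)) nM'; have [x [/nM' nx M'x]] := CM' n.
(* A cluster point in [Om] would have a compact neighbourhood there, which the original sequence
   leaves. *)
have Bb : B b.
  move=> [x _ xb].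
  have [K [cK xK _]] := lkOm (@filterT _ (nbhs x) _).
  have [k kK] := end_rep_escape M cK.
  have jK : nbhs b (j @` interior K).
    rewrite -xb; apply: open_nbhs_nbhs; split; last by exists x.
    by apply: oj; exact: open_interior.
  have [y [M'y [v Kv vy]]] := clb k _ jK.
  have : (j @` val M k) y by rewrite -M'M; split => //; apply; exists v.
  move=> [u Mu uy]; have uv : u = v by apply: injj; rewrite uy.
  have : (K `&` val M k) v by split; [exact: (interior_subset Kv)|rewrite -uv].
  by rewrite kK.
exists (inl b) => Q; apply: (iff_trans (zQ Q)); split => [[n nQ]|bQ].
  have [S [[cS _] SB SM' _]] := M'P n.
  have nSb : ~ S b by move=> Sb; have : (S `&` B) b by []; rewrite SB.
  have M'b : M' n b.
    apply: (is_component_closure lcT (closed_openC (compact_closed hT cS)) SM').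
    by split.
  exact: (@filterS _ (nbhs b) _ _ _ nQ (open_nbhs_nbhs (conj (oM' n) M'b))).
have [h [k [hk h0 DQ]]] := interior_disc_chart (Bint Bb) bQ.
have [r [r0 r1 nr]] := generic_disc_radius cB h k (@ltr01 R).
pose C' := h @` [set p | `|p| = r].
have cC' : compact C'.
  apply: disc_chart_compact hk _ _; last by move=> p /= pr; rewrite /sq/= pr.
  apply: (subclosed_compact _ (@compact_csq R r)); last by move=> p /= pr; rewrite /csq/= pr.
  rewrite (_ : mkset _ = (Num.norm : R * R -> R) @^-1` [set r]) //.
  by apply: preimage_closed; [move=> p _; exact: norm_continuous|exact: closed_eq].
have C'B : C' `<=` range j.
  move=> _ [p /= pr <-]; apply: contrapT => Bp.
  by have := nr p Bp hk; rewrite pr r1 eqxx => /(_ erefl).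
have [x0 Mx0] := end_rep_neq0 M 0; have [g [gK cg]] := embedding_inverse x0.
have cgC' : compact (g @` C').
  by apply: continuous_on_compact cC'; exact: continuous_on_sub cg.
(* The square boundary is compact in [Om], so [M' n] misses it for some [n]; connected and adherent
   to [b], it lies inside the square. *)
have [n nC'] := end_rep_escape M cgC'.
have M'C' y : M' n y -> ~ C' y.
  move=> M'y /[dup] C'y /C'B[x _ xy].
  have : (j @` val M n) y by rewrite -M'M; split => //; apply; exists x.
  move=> [u Mu uy]; have : (g @` C' `&` val M n) u.
    by split => //; exists y => //; rewrite -uy gK.
  by rewrite nC'.
have sqr1 : sq r `<=` sq 1 by move=> p pr; exact: lt_trans pr r1.
have csqr1 : csq r `<=` sq 1 by move=> p pr; exact: le_lt_trans pr r1.
have oD : open (h @` sq r) by exact: disc_chart_open hk (@open_sq R r) sqr1.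
have clD : closed (h @` csq r).
  by apply: compact_closed => //; exact: disc_chart_compact hk (@compact_csq R r) csqr1.
exists n; apply: subset_trans DQ.
apply: (@subset_trans _ (h @` sq r)); last exact: image_subset.
apply: (iffLR (connectedE _) (cM' n) _ (~` (h @` csq r))) => //.
- exact: closed_openC.
- move=> y M'y; have [[p pr py]|ny] := pselect ((h @` csq r) y); last by right.
  left; exists p => //; rewrite /sq/= lt_neqAle pr andbT; apply/eqP => pr'.
  by apply: (M'C' _ M'y); exists p.
- apply/seteqP; split => // y [[_ [p pr py]]]; apply.
  by exists p => //; exact: ltW.
- have bD : nbhs b (h @` sq r).
    apply: open_nbhs_nbhs; split => //; rewrite -h0; exists 0 => //.
    by rewrite /sq/= normr0.
  by have [y [M'y Dy]] := clb n _ bD; exists y.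
Qed.

End open_embedding.

(** * Points of [B] and ends of [T] come from ends of [Om] *)

Section open_embedding_surjective.
Context (R : realType) (Om T : topologicalType) (j : Om -> T).
Context (hT : hausdorff_space T) (sT : locally_surface R T).
Context (cj : continuous j) (injj : injective j).
Context (oj : forall V : set Om, open V -> open (j @` V)).

Let B := ~` range j.
Context (cB : countable B) (Bint : B `<=` surface_interior R T).

Let lcT : locally_connected T. Proof. exact: surface_locally_connected sT. Qed.
Let lkT : locally_compact_space T. Proof. exact: surface_locally_compact sT. Qed.
Let clB : closed B. Proof. by apply: open_closedC; apply: oj; exact: openT. Qed.

Lemma component_preimage (S M : set T) : compact_subsurface R S ->
  S `&` B = set0 -> is_component (~` S) M ->
  compact_subsurface R (j @^-1` S) /\ is_component (~` (j @^-1` S)) (j @^-1` M).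
Proof.
move=> sS SB SM; have [cS _] := sS.
have oS : open (~` S) by apply: closed_openC; exact: compact_closed.
have oM := is_component_open lcT oS SM.
have [z [Mz [y _ xy]]] : exists y, M y /\ range j y.
  have [y [My nBy]] := openD_neq0 cB Bint oM (is_component_neq0 SM).
  by exists y; split => //; exact: contrapT.
split; first exact: (embedding_subsurface_preimage hT cj injj oj y SB).
have -> : j @^-1` M = j @^-1` (M `\` B).
  by apply/seteqP; split=> x Mx; [split => //; apply; exists x|case: Mx].
apply: clopen_is_component.
- by exists y; rewrite /preimage/= xy; split => //; apply; exists y.
- by move=> x [Mx _]; exact: is_component_sub SM _ Mx.
- apply: (embedding_connected_preimage injj oj).
    exact: connectedD_countable cB Bint oM (is_component_connected SM).
  by move=> u [_ nBu]; exact: contrapT.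
- by apply: open_comp; [move=> x _; exact: cj|apply: openI => //; exact: closed_openC].
- move=> x [clx nSx]; split; last by apply; exists x.
  apply: (is_component_closure lcT oS SM); split => //.
  move=> V xV; have [v [[Mv _] Vv]] := clx _ (cj xV).
  by exists (j v).
Qed.

(** Treats points of [B] and ends of [T] together. Components missing [B] along their frontier form
    a countably generated basis at [w]; a decreasing choice among them represents an end of [Om],
    provided that [w] can be separated from compact sets of [Om]. *)
Lemma same_trace_of_basis w :
  (forall Q, end_nbhs w Q -> exists S M, [/\ compact_subsurface R S,
     S `&` B = set0, is_component (~` S) M, end_nbhs w M & M `<=` Q]) ->
  (forall C, compact C -> C `&` B = set0 ->
     exists2 Q, end_nbhs w Q & Q `&` C = set0) ->
  (exists2 V : nat -> set T, forall n, end_nbhs w (V n) &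
     forall Q, end_nbhs w Q -> exists n, V n `<=` Q) ->
  (forall P Q, end_nbhs w P -> end_nbhs w Q -> end_nbhs w (P `&` Q)) ->
  exists e : end_space R Om, same_trace j (inr e) w.
Proof.
move=> wS wC [V wV VQ] wI.
pose P M := end_nbhs w M /\ exists S, [/\ compact_subsurface R S,
  S `&` B = set0 & is_component (~` S) M].
(* The set chosen at stage [n] is indexed by [n.+1], whence the shift in [MV]. *)
pose r (n : nat) (M M' : set T) := M' `<=` M `&` V n.
have [S0 [M0 [sS0 SB0 SM0 wM0 _]]] := wS _ (wV 0%N).
have [||M [_ MP]] := @dependent_choice _ P r M0.
- by split => //; exists S0.
- move=> n M [wM _]; have [S [M' [sS SB SM' wM' M'M]]] := wS _ (wI _ _ wM (wV n)).
  by exists M'; split => //; split => //; exists S.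
have decM n : M n.+1 `<=` M n by have [_ MM] := MP n => x /MM[].
have MV n : M n.+1 `<=` V n by have [_ MM] := MP n => x /MM[].
have leM n m : (n <= m)%N -> M m `<=` M n.
  elim: m => [|m IH]; first by rewrite leqn0 => /eqP ->.
  by rewrite leq_eqVlt => /predU1P[->//|/IH]; exact: subset_trans.
pose N n := j @^-1` (M n).
have Nend : end_sequence R Om N.
  split.
  - by move=> n x; exact: decM.
  - move=> n; have [[_ [S [sS SB SM]]] _] := MP n.
    by have [sjS jSM] := component_preimage sS SB SM; exists (j @^-1` S).
  - move=> C cC; have cjC : compact (j @` C).
      by apply: continuous_on_compact cC; exact: continuous_continuous_on.
    have [|Q wQ QC] := wC _ cjC.
      by apply/seteqP; split => // _ [[x _ <-]]; apply; exists x.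
    have [n nQ] := VQ Q wQ; exists n.+1 => // m /= nm.
    apply/seteqP; split => // x [Cx Mx].
    have : (Q `&` j @` C) (j x); last by rewrite QC.
    by split; [apply: nQ; apply: MV; exact: leM nm _ Mx|exists x].
pose N' : end_rep R Om := SigSub (mem_set Nend).
have [f Nf] : exists f, represents N' f by eexists.
exists f => Q; apply: (iff_trans (end_inP Q Nf)); split=> [[n nQ]|wQ].
- have [[wM _] _] := MP n; apply: end_nbhsS wM => y My.
  have [[x _ xy]|ny] := pselect (range j y); last by right.
  by left; exists x => //; apply: nQ; rewrite -xy in My.
- have [n nQ] := VQ _ wQ; exists n.+1 => x Mx.
  by have [[v Qv /injj <-]//|] := nQ _ (MV _ _ Mx); case; exists x.
Qed.

Lemma same_trace_point b : B b ->
  exists e : end_space R Om, same_trace j (inr e) (inl b).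
Proof.
move=> Bb; apply: same_trace_of_basis.
- move=> Q /= bQ.
  have [S [M [rS SM bM MQ]]] := annulus_removable hT cB Bint Bb bQ lcT.
  have [S' [sS' S'S SS' S'B]] := cut_countable hT cB clB Bint rS.
  exists S', M; split => //; apply: is_component_cut SS' SM => //.
  by apply: compact_closed => //; case: rS => -[].
- move=> C cC CB; exists (~` C); last by rewrite setICl.
  apply: open_nbhs_nbhs; split; first by apply: closed_openC; exact: compact_closed.
  by move=> Cb; have : (C `&` B) b by []; rewrite CB.
- have [h [k [hk h0 _]]] := interior_disc_chart (Bint Bb) (@filterT _ (nbhs b) _).
  have n1 n : (n.+1%:R^-1 : R) <= 1 by rewrite invf_le1 ?ltr0n// ler1n.
  exists (fun n => h @` sq n.+1%:R^-1).
    move=> n; apply: open_nbhs_nbhs; split.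
      apply: disc_chart_open hk _ _; first exact: open_sq.
      by move=> p pn; exact: lt_le_trans pn (n1 n).
    by rewrite -h0; exists 0 => //; rewrite /sq/= normr0 invr_gt0 ltr0n.
  move=> Q /=; rewrite -h0 => hQ; have [_ [_ _ ch _]] := hk.
  have sq0 : sq 1 (0 : R * R) by rewrite /sq/= normr0.
  have /nbhs_ballP[e /= e0 eQ] := ch _ sq0 _ hQ.
  have [n ne] : exists n, (n.+1%:R^-1 : R) < e.
    exists (Num.truncn e^-1); rewrite invf_plt ?posrE ?ltr0n//.
    exact: truncnS_gt.
  exists n => _ [p pn <-]; apply: eQ; last by apply: lt_le_trans pn (n1 n).
  by rewrite -ball_normE /ball_/= sub0r normrN; exact: lt_trans ne.
- by move=> P Q bP bQ; exact: (@filterI _ (nbhs b) _ _ _ bP bQ).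
Qed.

(** Two pushes are needed. Bad points away from [val M n] are cleared without touching [val M m];
    those inside [val M n], possibly on the frontier of [val M m], can be cleared only by moving
    that component. *)
Lemma end_rep_removable (M : end_rep R T) n : exists S M', [/\ removable R B S,
  is_component (~` S) M', M' `<=` val M n & exists k, val M k `<=` M'].
Proof.
have [m mn] := end_rep_closure lkT M n.
have [S [cS sS] SM] := end_rep_component M m.
have cloM : open (~` closure (val M m)) by apply/closed_openC/closed_closure.
have clS : closed S by exact: compact_closed.
have oMn := end_rep_open hT lcT M n.
have clbad A : closed A -> closed (bad_on A).
  by move=> cA; apply: closedI => //; apply: open_closedC; exact: open_interior.
pose K := B `&` (bad_on S `&` ~` val M n).
have cK : compact K.
  apply: (subclosed_compact _ cS); last by move=> x [_ [[]]].
  apply: closedI => //; apply: closedI; first exact: clbad.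
  exact: open_closedC.
have [|t [t' [Q [cQ QO] [tt Qt tS]]]] :=
    ambient_push hT cloM cB Bint cK _ clS.
  by move=> x [Bx [_ nMx]]; split => // /mn.
pose S1 := t @^-1` S; have [ct ct' tK tK'] := tt.
have homeoS (s s' : T -> T) A : ambient_homeo s s' -> compact_subsurface R A ->
    compact_subsurface R (s @^-1` A).
  move=> [cs cs' sK sK']; apply: (@compact_subsurface_homeo _ _ _ _ _ s' s) => //.
  split; [|by []|exact: continuous_continuous_on|exact: continuous_continuous_on].
  by move=> x Ax; rewrite /preimage/= sK'.
have sS1 : compact_subsurface R S1 by exact: homeoS tt _.
have tM : t @^-1` val M m = val M m.
  apply/seteqP; split=> x Mx.
    have nQ : ~ Q (t x) by move=> /QO; apply; exact: subset_closure.
    by rewrite -(can_inj tK (Qt _ nQ)).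
  rewrite /preimage/= Qt// => /QO; apply; exact: subset_closure.
have S1M : is_component (~` S1) (val M m).
  by rewrite -tM; exact: is_component_homeo tt SM.
have clS1 : closed S1 by case: sS1 => cS1 _; exact: compact_closed.
have badS1 b : B b -> bad_on S1 b -> val M n b.
  move=> Bb /(tS _ Bb)[bS nK]; apply: contrapT => nM; apply: nK.
  by split.
have cK1 : compact (B `&` bad_on S1).
  case: (sS1) => cS1 _; apply: (subclosed_compact _ cS1); last by move=> x [_ []].
  by apply: closedI => //; exact: clbad.
(* The support [Q'] lies in [val M n], which keeps the moved component there, and is compact, so
   that late members of the sequence are fixed and remain in it. *)
have [|s [s' [Q' [cQ' QO'] [ss Qs sS1']]]] :=
    ambient_push hT oMn cB Bint cK1 _ clS1.
  by move=> x [Bx /(badS1 _ Bx) Mx].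
have [cs cs' sK sK'] := ss.
exists (s @^-1` S1), (s @^-1` val M m); split.
- split; first exact: homeoS ss _.
  move=> b Bb Sb; apply: contrapT => nSb.
  by have [] := sS1' b Bb (conj Sb nSb); move=> bS1; apply.
- exact: is_component_homeo ss S1M.
- move=> x Mx; have [Qx|nQx] := pselect (Q' x); first exact: QO'.
  by move: Mx; rewrite /preimage/= Qs// => Mx; apply: mn; exact: subset_closure.
- have [k kQ] := end_rep_escape M cQ'; exists (maxn k m) => x Mx.
  rewrite /preimage/= Qs; first by apply: end_rep_decr Mx; exact: leq_maxr.
  move=> Qx; have : (Q' `&` val M (maxn k m)) x by [].
  by rewrite kQ// leq_maxl.
Qed.

Lemma same_trace_end (f : end_space R T) :
  exists e : end_space R Om, same_trace j (inr e) (inr f).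
Proof.
have [M Mf] := end_repP f.
apply: same_trace_of_basis.
- move=> Q fQ; have [n nQ] := fQ M Mf.
  have [S [M' [rS SM' M'M [k kM']]]] := end_rep_removable M n.
  have [S' [sS' S'S SS' S'B]] := cut_countable hT cB clB Bint rS.
  exists S', M'; split => //.
  + apply: is_component_cut SS' SM' => //.
    by apply: compact_closed => //; case: rS => -[].
  + by apply/(end_inP _ Mf); exists k.
  + exact: subset_trans nQ.
- move=> C cC _; have [k kC] := end_rep_escape M cC.
  exists (val M k); last by rewrite setIC kC.
  by apply/(end_inP _ Mf); exists k.
- exists (fun n => val M n); last by move=> Q /(_ M Mf).
  by move=> n; apply/(end_inP _ Mf); exists n.
- move=> P Q fP fQ N Nf; have [n nP] := fP N Nf; have [m mQ] := fQ N Nf.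
  exists (maxn n m) => x Nx; split.
  + by apply: nP; apply: end_rep_decr Nx; exact: leq_maxl.
  + by apply: mQ; apply: end_rep_decr Nx; exact: leq_maxr.
Qed.

Theorem open_embedding_extension :
  exists2 F : end_compactification R Om -> end_compactification R T,
    homeomorphism F & forall x, F (inl x) = inl (j x).
Proof.
have [||z|w|z w V zw oV Vw|z w V zw oV Vz|F hF FE] :=
  @relation_homeo _ _ (@same_trace R Om T j).
- have sOm := embedding_locally_surface sT cj injj oj.
  apply: end_compactification_hausdorff.
  + exact: (embedding_hausdorff hT cj injj).
  + exact: surface_locally_connected sOm.
  + exact: surface_locally_compact sOm.
- exact: end_compactification_hausdorff.
- exact: (same_trace_total hT sT cj injj oj cB Bint).
- case: w => [y|f]; last by have [e ef] := same_trace_end f; exists (inr e).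
  have [[x _ <-]|By] := pselect (range j y).
    by exists (inl x); exact: (same_trace_inl R cj injj oj).
  by have [e eb] := same_trace_point By; exists (inr e).
- exact: (same_trace_cont hT sT cj cB Bint zw oV Vw).
- exact: (same_trace_cont' hT sT cj injj oj zw oV Vz).
- by exists F => // x; apply: FE; exact: (same_trace_inl R cj injj oj).
Qed.

End open_embedding_surjective.

(** * Extension to open subsurfaces *)

Section partial_homeo.
Context (R : realType) (T1 T2 : topologicalType).
Context (hT1 : hausdorff_space T1) (hT2 : hausdorff_space T2).
Context (sT1 : locally_surface R T1) (sT2 : locally_surface R T2).
Context (A1 : set T1) (A2 : set T2) (cA1 : countable A1) (cA2 : countable A2).
Context (A1int : A1 `<=` surface_interior R T1).
Context (A2int : A2 `<=` surface_interior R T2).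
Context (f : ~` A1 -> ~` A2) (g : ~` A2 -> ~` A1).
Context (cf : continuous f) (cg : continuous g) (fK : cancel f g) (gK : cancel g f).

(** Membership of [(x, y)] in the closure of the graph of [u]; this is symmetric under passing to
    the inverse. *)
Definition adherent (X Y : topologicalType) (A : set X) (C : set Y)
    (u : ~` A -> ~` C) (x : X) (y : Y) :=
  forall U V, nbhs x U -> nbhs y V -> exists z, U (val z) /\ V (val (u z)).

Lemma adherent_sym x y : adherent f x y -> adherent g y x.
Proof.
move=> xy V U yV xU; have [z [Uz Vz]] := xy U V xU yV.
by exists (f z); rewrite fK.
Qed.

Lemma adherent_graph z : adherent f (val z) (val (f z)).
Proof. by move=> U V zU zV; exists z; split; exact: nbhs_singleton. Qed.

Lemma adherent_left (z : ~` A1) y : adherent f (val z) y -> y = val (f z).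
Proof.
move=> zy; apply: hT2 => V W yV zW.
have : nbhs z (f @^-1` (val @^-1` W)) by apply: cf; exact: initial_continuous.
move=> [_ [[U oU <-] /= Uz] UW].
have [v [Uv Vv]] := zy U V (open_nbhs_nbhs (conj oU Uz)) yV.
by exists (val (f v)); split => //; exact: UW.
Qed.

Lemma adherent_right x (w : ~` A2) : adherent f x (val w) -> x = val (g w).
Proof.
move=> xw; apply: hT1 => V W xV wW.
have : nbhs w (g @^-1` (val @^-1` W)) by apply: cg; exact: initial_continuous.
move=> [_ [[U oU <-] /= Uw] UW].
have [v [Vv Uv]] := xw V U xV (open_nbhs_nbhs (conj oU Uw)).
exists (val v); split => //; have := UW _ Uv.
by rewrite /preimage/= fK.
Qed.

(* A generic small square around [y] has a compact boundary that avoids [A2];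
   the image of a small punctured disc around [x] is connected and avoids it. *)
Lemma adherent_cvg x y V : adherent f x y -> nbhs y V ->
  exists2 U, nbhs x U & forall z, U (val z) -> V (val (f z)).
Proof.
move=> xy yV; have [A1x|nA1x] := pselect (A1 x); last first.
  pose z : ~` A1 := SigSub (mem_set (nA1x : (~` A1) x)).
  have yE : y = val (f z) by exact: adherent_left.
  have : nbhs z (f @^-1` (val @^-1` V)).
    by apply: cf; apply: initial_continuous; rewrite yE in yV.
  move=> [_ [[U oU <-] /= Uz] UV]; exists U; first exact: open_nbhs_nbhs.
  by move=> v Uv; exact: UV.
(* Otherwise [x] would be the value of [g] at [y], which lies outside [A1]. *)
have A2y : A2 y.
  apply: contrapT => nA2y; pose w : ~` A2 := SigSub (mem_set (nA2y : (~` A2) y)).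
  have xE : x = val (g w) by exact: adherent_right.
  by apply: (set_mem (valP (g w))); rewrite /= -[sval _]xE.
have [h [k [hk h0 DV]]] := interior_disc_chart (A2int A2y) yV.
have [r [r0 r1 nr]] := generic_disc_radius cA2 h k (@ltr01 R).
pose C := h @` [set p | `|p| = r].
have cC : compact C.
  apply: disc_chart_compact hk _ _; last by move=> p /= pr; rewrite /sq/= pr.
  apply: (subclosed_compact _ (@compact_csq R r)); last by move=> p /= pr; rewrite /csq/= pr.
  rewrite (_ : mkset _ = (Num.norm : R * R -> R) @^-1` [set r]) //.
  by apply: preimage_closed; [move=> p _; exact: norm_continuous|exact: closed_eq].
have CA2 w : C w -> ~ A2 w.
  move=> [p /= pr <-] A2p.
  by have := nr p A2p hk; rewrite pr r1 eqxx => /(_ erefl).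
(* Every point of [C] has a [g]-value different from [x]; separating these values from [x] and using
   compactness of [C] gives a uniform neighbourhood. *)
have xC : nbhs x [set x' | forall z, val z = x' -> ~ C (val (f z))].
  pose Q x' y' := ~ exists z, val z = x' /\ val (f z) = y'.
  suff : nbhs x [set x' | C `<=` Q x'].
    by apply: filterS => x' CQ z zx' Cz; apply: (CQ _ Cz); exists z.
  move/compact_near_coveringP : cC; apply => w Cw.
  pose w' : ~` A2 := SigSub (mem_set (CA2 _ Cw : (~` A2) w)).
  have xw : x != val (g w').
    apply/eqP => xE; apply: (set_mem (valP (g w'))).
    by rewrite /= -[sval _]xE.
  move: hT1; rewrite open_hausdorff => /(_ _ _ xw)[[P P'] /= [xP wP] [oP oP' PP']].
  have : nbhs w' (g @^-1` (val @^-1` P')).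
    apply: cg; apply: initial_continuous; apply: open_nbhs_nbhs; split => //.
    exact: set_mem.
  move=> [_ [[W oW <-] /= Ww] WP'].
  exists (W, P); first by split; apply: open_nbhs_nbhs; split => //; exact: set_mem.
  move=> [y' x'] /= [Wy' Px'] [z [zx' zy']].
  have : (P `&` P') (val z).
    split; first by rewrite zx'.
    have : (g @^-1` (val @^-1` P')) (f z) by apply: WP'; rewrite /preimage/= -zy' in Wy' *.
    by rewrite /preimage/= fK.
  by rewrite (eqP PP').
have [h' [k' [hk' h'0 D'C]]] := interior_disc_chart (A1int A1x) xC.
have [oD' _] := hk'; have D'x : (h' @` sq 1) x.
  by rewrite -h'0; exists 0 => //; rewrite /sq/= normr0.
exists (h' @` sq 1); first exact: open_nbhs_nbhs.
have [cD' _] := disc_chart_connectedD hk' cA1.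
pose E : set (~` A1) := val @^-1` (h' @` sq 1 `\` A1).
have cE : connected E.
  apply: connected_preimage cD' _ => [_ [V' oV' <-]|z [_ nAz]]; first by exists V'.
  by exists (SigSub (mem_set (nAz : (~` A1) z))).
have cfE : connected ((val \o f) @` E).
  apply: continuous_on_connected cE; apply: continuous_continuous_on => z.
  by apply: continuous_comp; [exact: cf|exact: initial_continuous].
have Ez z : (h' @` sq 1) (val z) -> E z.
  by move=> Dz; split => //; exact: set_mem (valP z).
have sqr1 : sq r `<=` sq 1 by move=> p pr; exact: lt_trans pr r1.
have csqr1 : csq r `<=` sq 1 by move=> p pr; exact: le_lt_trans pr r1.
have oD : open (h @` sq r) by exact: disc_chart_open hk (@open_sq R r) sqr1.
have clD : closed (h @` csq r).
  by apply: compact_closed => //; exact: disc_chart_compact hk (@compact_csq R r) csqr1.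
have fED : (val \o f) @` E `<=` h @` sq r.
  apply: (iffLR (connectedE _) cfE _ (~` (h @` csq r))) => //.
  - exact: closed_openC.
  - move=> _ [z [Dz _] <-] /=.
    have [[p pr py]|ny] := pselect ((h @` csq r) (val (f z))); last by right.
    left; exists p => //; rewrite /sq/= lt_neqAle pr andbT; apply/eqP => pr'.
    by apply: (D'C _ Dz z erefl); exists p.
  - apply/seteqP; split => // w [[_ [p pr py]]]; apply.
    by exists p => //; exact: ltW.
  - have yD : nbhs y (h @` sq r).
      apply: open_nbhs_nbhs; split => //; rewrite -h0; exists 0 => //.
      by rewrite /sq/= normr0.
    have [z [Dz fz]] := xy _ _ (open_nbhs_nbhs (conj oD' D'x)) yD.
    by exists (val (f z)); split => //; exists z => //; exact: Ez.
move=> z Dz; have [|p pr <-] := fED (val (f z)); first by exists z => //; exact: Ez.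
by apply: DV; exists p => //; exact: sqr1.
Qed.

Lemma adherent_uniq x y y' : adherent f x y -> adherent f x y' -> y = y'.
Proof.
move=> xy xy'; apply: hT2 => V V' yV y'V'.
have [U xU UV] := adherent_cvg xy yV.
have [z [Uz Vz]] := xy' U V' xU y'V'.
by exists (val (f z)); split => //; exact: UV.
Qed.

(** Near [x] all values of [f] lie in a compact [K] inside [V], so they cluster in [K] at each
    nearby [x']. This yields openness of the domain of the extension as well as its continuity. *)
Lemma adherent_near x y V : adherent f x y -> nbhs y V ->
  exists2 U, nbhs x U & forall x', U x' -> exists2 y', V y' & adherent f x' y'.
Proof.
move=> xy yV.
have [K [cK yK KV]] := surface_locally_compact sT2 yV.
have [U xU UK] := adherent_cvg xy yK.
exists (interior U); first exact: nbhs_interior.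
move=> x' Ux'.
(* The image under [f] of the neighbourhood filter of [x']; it is proper because [A1] contains no
   nonempty open set. *)
pose F : set_system T2 :=
  [set W | nbhs x' [set x'' | forall z, val z = x'' -> W (val (f z))]].
have FF : ProperFilter F.
  split.
    rewrite /F/= nbhsE => -[W [oW Wx'] W0].
    have [|v [Wv nv]] := openD_neq0 cA1 A1int oW; first by exists x'.
    exact: (W0 _ Wv (SigSub (mem_set (nv : (~` A1) v)))).
  split.
  - exact: (@filterE _ (nbhs x') _ _ (fun v z _ => I)).
  - move=> P Q FP FQ.
    apply: (@filterS _ (nbhs x') _ _ _ _ (@filterI _ (nbhs x') _ _ _ FP FQ)).
    move=> v [Pv Qv] z zv.
    by split; [exact: Pv|exact: Qv].
  - by move=> P Q PQ; apply: (@filterS _ (nbhs x')) => v Pv z zv; apply: PQ; exact: Pv.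
have FK : F K by apply: (filterS _ Ux') => v Uv z zv; apply: UK; rewrite zv.
have [y' [Ky' cly']] := cK F FF FK.
exists y'; first exact: KV.
move=> P Q xP yQ.
have FP : F [set w | exists2 z, P (val z) & val (f z) = w].
  by apply: (filterS _ xP) => v Pv z zv; exists z => //; rewrite zv.
by have [_ [[z Pz <-] Qz]] := cly' _ _ FP yQ; exists z.
Qed.

End partial_homeo.

(** [Om] is the closure of the graph of [f], realized as its projection to [T1]. Uniqueness of
    adherent points in both directions makes both projections injective, and [adherent_near] makes
    them open. *)
Lemma common_open_surface (R : realType) (T1 T2 : topologicalType)
    (A1 : set T1) (A2 : set T2) (f : ~` A1 -> ~` A2) :
  hausdorff_space T1 -> hausdorff_space T2 ->
  locally_surface R T1 -> locally_surface R T2 ->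
  countable A1 -> countable A2 ->
  A1 `<=` surface_interior R T1 -> A2 `<=` surface_interior R T2 ->
  homeomorphism f ->
  exists (Om : topologicalType) (j1 : Om -> T1) (j2 : Om -> T2),
    [/\ [/\ continuous j1, injective j1, forall V, open V -> open (j1 @` V) &
            ~` range j1 `<=` A1],
        [/\ continuous j2, injective j2, forall V, open V -> open (j2 @` V) &
            ~` range j2 `<=` A2] &
        forall z, exists x, j1 x = val z /\ j2 x = val (f z)].
Proof.
move=> hT1 hT2 sT1 sT2 cA1 cA2 A1int A2int [cf [g [cg fK gK]]].
have funiq := adherent_uniq hT1 hT2 cA1 cA2 A1int A2int cf cg fK.
have guniq := adherent_uniq hT2 hT1 cA2 cA1 A2int A1int cg cf gK.
have fnear := adherent_near hT1 hT2 sT2 cA1 cA2 A1int A2int cf cg fK.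
have gnear := adherent_near hT2 hT1 sT1 cA2 cA1 A2int A1int cg cf gK.
pose O := [set x | exists y, adherent f x y].
have oO : open O.
  rewrite openE => x [y xy].
  have [U xU UO] := fnear _ _ _ xy (@filterT _ (nbhs y) _).
  by apply: (filterS _ xU) => x' /UO[y' _ xy']; exists y'.
have /choice[j2 j2P] : forall x : O, exists y, adherent f (val x) y.
  by move=> x; exact: set_mem (valP x).
have j2E (x : O) y : adherent f (val x) y -> j2 x = y by exact: funiq.
have zO (z : ~` A1) : O (val z) by exists (val (f z)); exact: adherent_graph.
exists O, val, j2; split; first split.
- exact: initial_continuous.
- exact: val_inj.
- move=> _ [V oV <-]; rewrite (_ : val @` _ = O `&` V); first exact: openI.
  apply/seteqP; split=> [_ [x Vx <-]|x [Ox Vx]].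
    by split => //; exact: set_mem (valP x).
  by exists (SigSub (mem_set Ox)).
- move=> x nx; apply: contrapT => nAx; apply: nx.
  have Ox := zO (SigSub (mem_set (nAx : (~` A1) x))).
  by exists (SigSub (mem_set Ox)).
- split.
  + move=> x V xV; have [U xU UV] := fnear _ _ _ (j2P x) xV.
    have : nbhs x (val @^-1` U) by exact: initial_continuous.
    apply: filterS => x' /UV[y' Vy' xy'].
    by rewrite /preimage/= (j2E _ _ xy').
  + move=> x x' xx'; apply: val_inj.
    apply: (guniq (j2 x)); apply: adherent_sym fK _ _ _; first exact: j2P.
    by rewrite xx'; exact: j2P.
  + move=> _ [V oV <-]; rewrite openE => _ [x Vx <-].
    have xV : nbhs (val x) V by exact: open_nbhs_nbhs.
    have [W yW WV] := gnear _ _ _ (adherent_sym fK (j2P x)) xV.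
    apply: (filterS _ yW) => y' /WV[x' Vx' /(adherent_sym gK) xy'].
    have Ox' : O x' by exists y'.
    by exists (SigSub (mem_set Ox')) => //; exact: j2E.
  + move=> y ny; apply: contrapT => nAy; apply: ny.
    pose w : ~` A2 := SigSub (mem_set (nAy : (~` A2) y)).
    exists (SigSub (mem_set (zO (g w)))) => //; apply: j2E => /=.
    by have := @adherent_graph _ _ _ _ f (g w); rewrite gK.
- move=> z; exists (SigSub (mem_set (zO z))); split => //.
  by apply: j2E; exact: adherent_graph.
Qed.

(** * The main theorem *)

Lemma homeomorphism_comp (X Y Z : topologicalType) (u : Y -> Z) (v : X -> Y) :
  homeomorphism u -> homeomorphism v -> homeomorphism (u \o v).
Proof.
move=> [cu [u' [cu' uK uK']]] [cv [v' [cv' vK vK']]]; split.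
  by move=> x; apply: continuous_comp; [exact: cv|exact: cu].
exists (v' \o u'); split.
- by move=> x; apply: continuous_comp; [exact: cu'|exact: cv'].
- exact: can_comp.
- exact: can_comp.
Qed.

(** * Ends corresponding to interior points are planar *)

Section extension.
Context (R : realType).

Lemma continuous_inl (T : topologicalType) :
  continuous (inl : T -> end_compactification R T).
Proof. by apply/continuousP => V []. Qed.

Definition finite_part (T : topologicalType) (x0 : T)
    (z : end_compactification R T) : T := if z is inl x then x else x0.

Lemma continuous_finite_part (T : topologicalType) (x0 : T) :
  continuous_on (range (inl : T -> end_compactification R T)) (finite_part x0).
Proof.
move=> _ [x _ <-] V /= xV.
have oV : open (inl @` interior V : set (end_compactification R T)).
  by apply: open_inl; exact: open_interior.
have Vx : (inl @` interior V : set (end_compactification R T)) (inl x) by exists x.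
apply: (filterS _ (open_nbhs_nbhs (conj oV Vx))) => _ [v Vv <-] _ /=.
exact: interior_subset.
Qed.

(** The inverse homeomorphism sends some [val M n] into a disc around [a], and the chart of the disc
    then embeds it in the plane. *)
Lemma planar_end_of_interior (T1 T2 : topologicalType)
    (F : end_compactification R T1 -> end_compactification R T2) a e :
  homeomorphism F -> surface_interior R T1 a -> F (inl a) = inr e ->
  planar_end e.
Proof.
move=> [cF [G [cG FK GK]]] aint Fa.
have [h [k [hk h0 _]]] := interior_disc_chart aint (@filterT _ (nbhs a) _).
have [oD [_ _ ch ck]] := hk.
have oD' : open (inl @` (h @` sq 1) : set (end_compactification R T1)).
  exact: open_inl.
have [_ GD] : open (G @^-1` (inl @` (h @` sq 1))).
  by apply: open_comp => // z _; exact: cG.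
have [|P [_ eP] PD] := GD e.
  rewrite /preimage/= -Fa FK; exists (h 0); last by rewrite h0.
  by exists 0 => //; rewrite /sq/= normr0.
have [M Me] := end_repP e; exists M => //.
have [n nP] := eP M Me; exists n.
have GM x : val M n x -> exists2 p, `|p| < 1 & G (inl x) = inl (h p).
  move=> Mx; have : end_hat P (inl x : end_compactification R T2) by exact: nP.
  by move=> /PD[_ [p p1 <-] <-]; exists p.
have [x0 Mx0] := end_rep_neq0 M n.
(* The defaults [a] and [x0] are never reached: on the sets considered, [G] and [F] take finite
   points to finite points. *)
pose al x := k (finite_part a (G (inl x))).
pose be p := finite_part x0 (F (inl (h p))).
exists (al @` val M n).
have alE x : val M n x -> exists2 p, `|p| < 1 &
    al x = p /\ F (inl (h p)) = inl x.
  move=> Mx; have [p p1 Gx] := GM x Mx; exists p => //; split.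
    by rewrite /al Gx /= (disc_chartK hk).
  by rewrite -Gx GK.
apply: (@homeo_on_homeomorphic _ _ _ _ al be); split.
- move=> x Mx; split; first by exists x.
  by have [p p1 [-> Fp]] := alE x Mx; rewrite /be Fp.
- move=> _ [x Mx <-]; have [p p1 [alx Fp]] := alE x Mx.
  have -> : be (al x) = x by rewrite alx /be Fp.
  by [].
- apply: (continuous_on_comp (B := h @` sq 1) _ _ ck).
    by move=> x /GM[p p1 ->]; exists p.
  apply: (continuous_on_comp (B := range (inl : T1 -> end_compactification R T1))
    (f := G \o inl) _ _
    (@continuous_finite_part _ a)).
    by move=> x /GM[p p1 /= ->]; exists (h p).
  apply: continuous_continuous_on => x.
  by apply: continuous_comp; [exact: continuous_inl|exact: cG].
- apply: (continuous_on_comp (B := range (inl : T2 -> end_compactification R T2))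
    (f := F \o inl \o h) _ _
    (@continuous_finite_part _ x0)).
    by move=> _ [x Mx <-]; have [p p1 [-> Fp]] := alE x Mx; exists x.
  apply: (continuous_on_comp (B := setT) (f := h) (g := F \o inl)) => //.
    by apply: continuous_on_sub ch => _ [x Mx <-]; have [p p1 [-> _]] := alE x Mx.
  apply: continuous_continuous_on => x.
  by apply: continuous_comp; [exact: continuous_inl|exact: cF].
Qed.

End extension.

Theorem theorem1p1 (R : realType) (T1 T2 : topologicalType)
    (surfT1 : surface R T1) (surfT2 : surface R T2)
    (connT1 : connected [set: T1]) (connT2 : connected [set: T2])
    (compact_bdT1 : compact (surface_boundary R T1))
    (compact_bdT2 : compact (surface_boundary R T2))
    (A1 : set T1) (A2 : set T2)
    (countA1 : countable A1) (countA2 : countable A2)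
    (denseA1 : dense A1) (denseA2 : dense A2)
    (A1_bd : A1 `&` surface_boundary R T1 = set0)
    (A2_bd : A2 `&` surface_boundary R T2 = set0)
    (f : ~` A1 -> ~` A2) (homeo_f : homeomorphism f) :
  (exists2 F : end_compactification R T1 -> end_compactification R T2,
     homeomorphism F &
     forall x : ~` A1, F (inl (val x)) = inl (val (f x))) /\
  ((forall e : end_space R T1, ~ planar_end e) ->
   (forall e : end_space R T2, ~ planar_end e) ->
   exists2 g : T1 -> T2, homeomorphism g &
     forall x : ~` A1, g (val x) = val (f x)).
Proof.
have [hT1 _ _] := surfT1; have [hT2 _ _] := surfT2.
have sT1 := surface_locally_surface surfT1.
have sT2 := surface_locally_surface surfT2.
have A1int : A1 `<=` surface_interior R T1.
  move=> x Ax; apply: contrapT => nx.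
  by have : (A1 `&` surface_boundary R T1) x by []; rewrite A1_bd.
have A2int : A2 `<=` surface_interior R T2.
  move=> x Ax; apply: contrapT => nx.
  by have : (A2 `&` surface_boundary R T2) x by []; rewrite A2_bd.
have [Om [j1 [j2 [[cj1 ij1 oj1 j1A] [cj2 ij2 oj2 j2A] jf]]]] :=
  common_open_surface hT1 hT2 sT1 sT2 countA1 countA2 A1int A2int homeo_f.
have [F1 [cF1 [G1 [cG1 F1K G1K]]] F1j] := open_embedding_extension hT1 sT1 cj1 ij1 oj1
  (sub_countable (subset_card_le j1A) countA1) (subset_trans j1A A1int).
have [F2 hF2 F2j] := open_embedding_extension hT2 sT2 cj2 ij2 oj2
  (sub_countable (subset_card_le j2A) countA2) (subset_trans j2A A2int).
(* [G1] removes the end compactification of [T1] to that of [Om], and [F2] carries it on to that of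
   [T2]; both fix the points of [Om]. *)
have hG1 : homeomorphism G1 by split => //; exists F1.
have hF : homeomorphism (F2 \o G1) by exact: homeomorphism_comp.
have Ff x : (F2 \o G1) (inl (val x)) = inl (val (f x)).
  by have [v [<- <-]] := jf x; rewrite /= -F1j F1K F2j.
split; first by exists (F2 \o G1).
move: (F2 \o G1) hF Ff => F hF Ff np1 np2.
have [cF [G [cG FK GK]]] := hF.
have hG : homeomorphism G by split => //; exists F.
have [_ [f' [_ fK f'K]]] := homeo_f.
(* Outside [A1] the value is given by [f]; a point of [A1] is interior, so it could go to an end
   only if that end were planar. *)
have /choice[g gE] : forall x, exists y, F (inl x) = inl y.
  move=> x; have [Ax|nAx] := pselect (A1 x); last first.
    by exists (val (f (SigSub (mem_set (nAx : (~` A1) x))))); rewrite -Ff.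
  case Fx : (F (inl x)) => [y|e]; first by exists y.
  by case: (np2 e); exact: planar_end_of_interior hF (A1int _ Ax) Fx.
have /choice[g' g'E] : forall y, exists x, G (inl y) = inl x.
  move=> y; have [Ay|nAy] := pselect (A2 y); last first.
    pose w : ~` A2 := SigSub (mem_set (nAy : (~` A2) y)); exists (val (f' w)).
    by rewrite -[inl y]/(inl (val w)) -{1}(f'K w) -Ff FK.
  case Gy : (G (inl y)) => [x|e]; first by exists x.
  by case: (np1 e); exact: planar_end_of_interior hG (A2int _ Ay) Gy.
have inl_inj (T : topologicalType) (x y : T) :
  (inl x : end_compactification R T) = inl y -> x = y by case.
(* Continuity passes to the restriction because [inl] is continuous and open. *)
have cont (X Y : topologicalType) (u : X -> Y)
    (H : end_compactification R X -> end_compactification R Y) :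
    continuous H -> (forall x, H (inl x) = inl (u x)) -> continuous u.
  move=> cH Hu; apply/continuousP => V oV.
  rewrite (_ : u @^-1` V = (H \o inl) @^-1` (inl @` V)).
    apply: open_comp; last exact: open_inl.
    by move=> x _; apply: continuous_comp; [exact: continuous_inl|exact: cH].
  apply/seteqP; split=> x; rewrite /preimage/= Hu.
    by move=> Vx; exists (u x).
  by move=> [y Vy /inl_inj <-].
exists g; last by move=> x; apply: inl_inj; rewrite -gE Ff.
split; first exact: cont cF gE.
exists g'; split.
- exact: cont cG g'E.
- by move=> x; apply: inl_inj; rewrite -g'E -gE FK.
- by move=> y; apply: inl_inj; rewrite -gE -g'E GK.
Qed.
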